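(* Let $n \ge 2$ and let $g$ be the Grauert metric on $(\mathbb C^n)^{\ast} = \mathbb C^n \setminus \{0\}$, as defined in the context. Then $K^+_g(z) \to +\infty$ as $|z| \to 0$. Furthermore, there exists $R > 0$ such that $K^-_g(z) < 0$ for all $z$ with $|z| \ge R$.
   Context: Let $u:(0,\infty)\to\mathbb R$ be $u(t) = \frac{t-1}{t\log t}$ for $t \neq 1$ and $u(1)=1$; it is positive and real analytic on $(0,\infty)$. Let $v(t) = \int_0^t \tau u^2(\tau)\,d\tau$ for $t>0$. For $z \in (\mathbb C^n)^\ast$ and a tangent vector $X \in \mathbb C^n$ at $z$, the Grauert metric is the K\''ahler metric $$g(z,X) = \Big(1 + \frac{v(|z|^2)}{|z|^2}\Big)|X|^2 + \Big(u^2(|z|^2) - \frac{v(|z|^2)}{|z|^4}\Big)|\langle X, z\rangle|^2,$$ where $\langle X,z\rangle = \sum_{j} X_j \overline{z_j}$ is the standard Hermitian inner product. If $h(T)|dT|^2$ is a Hermitian metric on a domain in $\mathbb C$, its Gaussian curvature is $-2 h^{-1}\,\partial^2 \log h/\partial T \partial \overline T$. The holomorphic sectional curvature $K_g(z,X)$ of $g$ at $z$ in the direction of a nonzero $X$ is the supremum, over all holomorphic maps $\phi$ from a neighbourhood of $0\in\mathbb C$ into $(\mathbb C^n)^\ast$ with $\phi(0)=z$ and $\phi'(0)=X$, of the Gaussian curvature at $0$ of the pulled-back metric $\phi^\ast g$. Set $K^+_g(z) = \sup_{X\neq 0} K_g(z,X)$ and $K^-_g(z) = \inf_{X \neq 0}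 K_g(z,X)$. *)

(* Defs.v *)
From Stdlib Require Import Reals.
From Coquelicot Require Import Coquelicot.
Open Scope R_scope.

(* Vectors of C^n are represented by functions nat -> C, of which only the
   components 0..n-1 are relevant. *)

Fixpoint sumR (n : nat) (f : nat -> R) : R :=
  match n with O => 0 | S m => sumR m f + f m end.

Fixpoint sumC (n : nat) (f : nat -> C) : C :=
  match n with O => RtoC 0 | S m => Cplus (sumC m f) (f m) end.

Definition sqnorm (n : nat) (X : nat -> C) : R := sumR n (fun j => (Cmod (X j)) ^ 2).

Definition herm (n : nat) (X z : nat -> C) : C :=
  sumC n (fun j => Cmult (X j) (Cconj (z j))).

Definition u (t : R) : R :=
  if Req_EM_T t 1 then 1 else (t - 1) / (t * ln t).

Definition v (t : R) : R :=
  RInt_gen (fun tau => tau * (u tau) ^ 2) (at_right 0) (at_point t).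

Definition grauert (n : nat) (z X : nat -> C) : R :=
  let r := sqnorm n z in
  (1 + v r / r) * sqnorm n X
  + ((u r) ^ 2 - v r / r ^ 2) * (Cmod (herm n X z)) ^ 2.

(* Gaussian curvature at 0 of the metric h(T)|dT|^2, T = s + i t:
   -2 h^{-1} d^2 log h / dT dTbar = -(1/2) h^{-1} (d_s^2 + d_t^2) log h. *)
Definition gauss_curv_at0 (h : C -> R) : R :=
  let F := fun s t => ln (h (s, t)) in
  - 2 / h (0, 0) * / 4 *
  (Derive (fun s => Derive (fun s' => F s' 0) s) 0
   + Derive (fun t => Derive (fun t' => F 0 t') t) 0).

Definition admissible (n : nat) (z X : nat -> C) (phi dphi : C -> nat -> C) : Prop :=
  (exists r : R, 0 < r /\
     forall T : C, Cmod T < r ->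
       sqnorm n (phi T) <> 0 /\
       forall j : nat, (j < n)%nat ->
         is_derive (K := C_AbsRing) (V := C_NormedModule)
           (fun T' => phi T' j) T (dphi T j)) /\
  (forall j : nat, (j < n)%nat -> phi (RtoC 0) j = z j /\ dphi (RtoC 0) j = X j).

Definition hsc (n : nat) (z X : nat -> C) : Rbar :=
  Rbar_lub (fun k : Rbar => exists phi dphi : C -> nat -> C,
     admissible n z X phi dphi /\
     k = Finite (gauss_curv_at0 (fun T => grauert n (phi T) (dphi T)))).

Definition Kplus (n : nat) (z : nat -> C) : Rbar :=
  Rbar_lub (fun k => exists X : nat -> C, sqnorm n X <> 0 /\ k = hsc n z X).

Definition Kminus (n : nat) (z : nat -> C) : Rbar :=
  Rbar_glb (fun k => exists X : nat -> C, sqnorm n X <> 0 /\ k = hsc n z X).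

(* Main.v *)
Require Import Defs.
From Stdlib Require Import Reals Lra Lia Classical ClassicalEpsilon.
From Coquelicot Require Import Coquelicot.
Open Scope R_scope.

(** In terms of r = |z|^2 the metric is a(r) |X|^2 + b(r) |<X,z>|^2 with a' = b.

    For X orthogonal to z the linear disk z + T X has curvature
    - 4 b / a^2 = 4 (v - r^2 u^2) / (r + v)^2; near 0, v(r) is of order 1 / |ln r| and r^2 u^2 of
    order 1 / ln^2 r, so this tends to infinity like |ln r|.

    For X = z and an arbitrary disk phi, the second-order expansion of g(phi, phi') shows that the
    curvature is that of the complex line through z, minus a nonnegative multiple of the squared
    norm of the component of phi''(0) orthogonal to z; the complex line has negative curvature
    for large r.  The expansion involves two derivatives of phi', whereas phi is only assumed to be
    complex differentiable; they are obtained from Goursat's theorem applied on a contracted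
    circle, and Cauchy's formula. *)

(** * Closed forms on rectangles *)

(** [hsc] is a supremum over disks, which makes the two halves unequal. For [Kplus], a supremum of
    suprema, one explicit disk suffices. [Kminus] is an infimum of suprema: one direction suffices,
    but every disk tangent to it must be bounded, and such a disk is only known to have a complex
    derivative. The curvature differentiates g(phi, phi') twice, and [Derive] is a total function
    that carries no information where the derivative fails to exist; this forces the Cauchy theory.
    In the radial direction phi''' has to exist but cancels between the two axes of the Laplacian.

    Goursat's theorem is stated for real forms P dx + Q dy. It then applies to real and imaginary
    parts separately, and to forms pulled back by maps that are not holomorphic, such as the
    contraction of a circle to an off-center point.

    The closed formulas for the derivatives of u^2 divide by ln t and are used only off t = 1, which
    is harmless since |z|^2 is either near 0 or large. *)

Definition circulation (P Q : R -> R -> R) (a c w h : R) : R :=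
  RInt (fun x => P x c) a (a + w) - RInt (fun x => P x (c + h)) a (a + w)
  + (RInt (fun y => Q (a + w) y) c (c + h) - RInt (fun y => Q a y) c (c + h)).

(** The shared [k] expresses P_y = Q_x at the point. No continuity of partial derivatives is asked,
    so Green's formula is out of reach and the subdivision argument takes its place. *)
Definition closed_form_at (P Q : R -> R -> R) (x y : R) : Prop :=
  exists px k qy, differentiable_pt_lim P x y px k /\ differentiable_pt_lim Q x y k qy.

Lemma continuous_slices (f : R -> R -> R) (x y lx ly : R) :
  differentiable_pt_lim f x y lx ly ->
  continuous (fun t => f t y) x /\ continuous (fun t => f x t) y.
Proof.
intros H.
assert (Hc : continuity_2d_pt f x y).
{ apply differentiable_continuity_pt. exists lx, ly. exact H. }
split; apply filterlim_locally; intros eps; specialize (Hc eps).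
- apply (locally_2d_1d_const_y _ _ _ Hc).
- apply (locally_2d_1d_const_x _ _ _ Hc).
Qed.

Lemma ex_RInt_continuous_on (f : R -> R) (a b : R) :
  a <= b -> (forall x, a <= x <= b -> continuous f x) -> ex_RInt f a b.
Proof.
intros Hab H. apply (ex_RInt_continuous (V := R_CompleteNormedModule)). intros x.
rewrite Rmin_left, Rmax_right by lra. apply H.
Qed.

Lemma RInt_near_const (f : R -> R) (a w k m : R) :
  0 <= w -> ex_RInt f a (a + w) ->
  (forall x, a <= x <= a + w -> Rabs (f x - k) <= m) ->
  Rabs (RInt f a (a + w) - k * w) <= m * w.
Proof.
intros Hw Hf H.
assert (E : forall c, RInt (fun _ => c) a (a + w) = c * w).
{ intros c. rewrite RInt_const. change ((a + w - a) * c = c * w). ring. }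
assert (H1 : RInt f a (a + w) <= (k + m) * w).
{ rewrite <- E. apply RInt_le; [lra | exact Hf | apply ex_RInt_const |].
  intros x Hx. assert (T := H x ltac:(lra)). apply Rabs_le_between in T. lra. }
assert (H2 : (k - m) * w <= RInt f a (a + w)).
{ rewrite <- E. apply RInt_le; [lra | apply ex_RInt_const | exact Hf |].
  intros x Hx. assert (T := H x ltac:(lra)). apply Rabs_le_between in T. lra. }
apply Rabs_le. lra.
Qed.

(** The affine parts of P and Q at the point contribute - k h w + k w h = 0 because the mixed
    coefficients agree. What remains is at most eps (w + h) on a boundary of length 2 (w + h).
    Closedness on the whole rectangle serves to make the edges integrable. *)
Lemma circulation_near_point (P Q : R -> R -> R) (x y : R) (eps : posreal) :
  closed_form_at P Q x y ->
  exists d, 0 < d /\ forall a c w h, 0 <= w < d -> 0 <= h < d ->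
    (forall s t, a <= s <= a + w -> c <= t <= c + h -> closed_form_at P Q s t) ->
    a <= x <= a + w -> c <= y <= c + h ->
    Rabs (circulation P Q a c w h) <= eps * (2 * (w + h) ^ 2).
Proof.
intros (px & k & qy & HP & HQ).
destruct (HP eps) as [d1 D1]. destruct (HQ eps) as [d2 D2].
exists (Rmin d1 d2). split. { apply Rmin_glb_lt; apply cond_pos. }
intros a c w h Hw Hh Hcl Hx Hy.
assert (M1 := Rmin_l d1 d2). assert (M2 := Rmin_r d1 d2).
assert (B : forall s t, a <= s <= a + w -> c <= t <= c + h ->
   Rabs (P s t - P x y - (px * (s - x) + k * (t - y))) <= eps * (w + h) /\
   Rabs (Q s t - Q x y - (k * (s - x) + qy * (t - y))) <= eps * (w + h)).
{ intros s t Hs Ht.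
  assert (A1 : Rabs (s - x) <= w) by (apply Rabs_le; lra).
  assert (A2 : Rabs (t - y) <= h) by (apply Rabs_le; lra).
  assert (A3 : Rmax (Rabs (s - x)) (Rabs (t - y)) <= w + h) by (apply Rmax_lub; lra).
  assert (E0 := cond_pos eps).
  split; (eapply Rle_trans; [apply D1 || apply D2; lra | apply Rmult_le_compat_l; lra]). }
assert (CP : forall t, c <= t <= c + h -> ex_RInt (fun s => P s t) a (a + w)).
{ intros t Ht. apply ex_RInt_continuous_on; [lra|]. intros s Hs.
  destruct (Hcl s t Hs Ht) as (? & ? & ? & H1 & H2). apply (continuous_slices _ _ _ _ _ H1). }
assert (CQ : forall s, a <= s <= a + w -> ex_RInt (fun t => Q s t) c (c + h)).
{ intros s Hs. apply ex_RInt_continuous_on; [lra|]. intros t Ht.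
  destruct (Hcl s t Hs Ht) as (? & ? & ? & H1 & H2). apply (continuous_slices _ _ _ _ _ H2). }
unfold circulation.
assert (I1 : Rabs (RInt (fun s => P s c - P s (c + h)) a (a + w) - (- k * h) * w)
             <= (2 * (eps * (w + h))) * w).
{ apply RInt_near_const; [lra | |].
  - apply (ex_RInt_minus (V := R_NormedModule)); apply CP; lra.
  - intros s Hs. destruct (B s c ltac:(lra) ltac:(lra)) as [B1 _].
    destruct (B s (c + h) ltac:(lra) ltac:(lra)) as [B2 _].
    apply Rabs_le_between in B1. apply Rabs_le_between in B2. apply Rabs_le. lra. }
assert (I2 : Rabs (RInt (fun t => Q (a + w) t - Q a t) c (c + h) - (k * w) * h)
             <= (2 * (eps * (w + h))) * h).
{ apply RInt_near_const; [lra | |].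
  - apply (ex_RInt_minus (V := R_NormedModule)); apply CQ; lra.
  - intros t Ht. destruct (B a t ltac:(lra) ltac:(lra)) as [_ B1].
    destruct (B (a + w) t ltac:(lra) ltac:(lra)) as [_ B2].
    apply Rabs_le_between in B1. apply Rabs_le_between in B2. apply Rabs_le. lra. }
rewrite (RInt_minus (V := R_CompleteNormedModule)) in I1 by (apply CP; lra).
rewrite (RInt_minus (V := R_CompleteNormedModule)) in I2 by (apply CQ; lra).
change (@minus R_CompleteNormedModule) with Rminus in I1, I2.
apply Rabs_le_between in I1. apply Rabs_le_between in I2. apply Rabs_le. change (fun y0 : R => Q (a + w) y0) with (Q (a + w)).
change (fun y0 : R => Q a y0) with (Q a). simpl. lra.
Qed.

Lemma circulation_quarters (P Q : R -> R -> R) (a c w h : R) :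
  0 <= w -> 0 <= h ->
  (forall s t, a <= s <= a + w -> c <= t <= c + h -> closed_form_at P Q s t) ->
  circulation P Q a c w h =
    circulation P Q a c (w / 2) (h / 2) + circulation P Q (a + w / 2) c (w / 2) (h / 2)
    + circulation P Q a (c + h / 2) (w / 2) (h / 2)
    + circulation P Q (a + w / 2) (c + h / 2) (w / 2) (h / 2).
Proof.
intros Hw Hh Hcl.
assert (CP : forall t, c <= t <= c + h ->
  RInt (fun s => P s t) a (a + w) =
  RInt (fun s => P s t) a (a + w / 2) + RInt (fun s => P s t) (a + w / 2) (a + w)).
{ intros t Ht. symmetry.
  apply (RInt_Chasles (V := R_CompleteNormedModule)); apply ex_RInt_continuous_on; try lra;
  intros s Hs; destruct (Hcl s t ltac:(lra) Ht) as (? & ? & ? & H1 & H2);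
  apply (continuous_slices _ _ _ _ _ H1). }
assert (CQ : forall s, a <= s <= a + w ->
  RInt (fun t => Q s t) c (c + h) =
  RInt (fun t => Q s t) c (c + h / 2) + RInt (fun t => Q s t) (c + h / 2) (c + h)).
{ intros s Hs. symmetry.
  apply (RInt_Chasles (V := R_CompleteNormedModule)); apply ex_RInt_continuous_on; try lra;
  intros t Ht; destruct (Hcl s t Hs ltac:(lra)) as (? & ? & ? & H1 & H2);
  apply (continuous_slices _ _ _ _ _ H2). }
unfold circulation.
rewrite (CP c), (CP (c + h)), (CQ a), (CQ (a + w)) by lra.
replace (a + w / 2 + w / 2) with (a + w) by field.
replace (c + h / 2 + h / 2) with (c + h) by field.
ring.
Qed.

(** Lower ends increase, upper ends decrease, and the gap w / 2^k tends to 0: nested intervals for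
    one coordinate of the shrinking rectangles. *)
Lemma halving_limit (a : nat -> R) (w : R) :
  0 <= w ->
  (forall k, a (S k) = a k \/ a (S k) = a k + w / 2 ^ k / 2) ->
  exists x, forall k, a k <= x <= a k + w / 2 ^ k.
Proof.
intros Hw Ha.
assert (W : forall k, 0 <= w / 2 ^ k).
{ intros k. apply Rdiv_le_0_compat; [lra|]. apply pow_lt; lra. }
assert (WS : forall k, w / 2 ^ S k = w / 2 ^ k / 2).
{ intros k. simpl. field. apply pow_nonzero; lra. }
assert (I : forall k, a k <= a (S k)).
{ intros k. specialize (W k). destruct (Ha k); lra. }
assert (D : forall k, a (S k) + w / 2 ^ S k <= a k + w / 2 ^ k).
{ intros k. rewrite WS. specialize (W k). destruct (Ha k); lra. }
destruct (ex_lim_seq_adj a (fun k => a k + w / 2 ^ k) I D) as (L1 & L2 & E).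
- apply is_lim_seq_ext with (fun k => w * (/ 2) ^ k).
  + intros k. rewrite pow_inv. unfold Rdiv. ring.
  + replace (Finite 0) with (Rbar_mult w 0) by (simpl; f_equal; ring).
    apply is_lim_seq_scal_l. apply is_lim_seq_geom. rewrite Rabs_right; lra.
- destruct L1 as [x L1]. destruct L2 as [x' L2].
  rewrite (is_lim_seq_unique _ _ L1), (is_lim_seq_unique _ _ L2) in E. inversion E; subst x'.
  exists x. intros k. split.
  + apply (is_lim_seq_incr_compare a x L1 I).
  + apply (is_lim_seq_decr_compare _ x L2 D).
Qed.

(** Some quarter of a rectangle carries at least a quarter of its circulation. Iterating, the
    quarters shrink to a point of the rectangle, where differentiability makes the circulation small
    compared with the square of the size. *)
Theorem goursat (P Q : R -> R -> R) (a c w h : R) :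
  0 <= w -> 0 <= h ->
  (forall s t, a <= s <= a + w -> c <= t <= c + h -> closed_form_at P Q s t) ->
  circulation P Q a c w h = 0.
Proof.
intros Hw Hh Hcl.
set (I := fun (p : R * R) (k : nat) =>
  Rabs (circulation P Q (fst p) (snd p) (w / 2 ^ k) (h / 2 ^ k))).
assert (W : forall z k, 0 <= z -> 0 <= z / 2 ^ k).
{ intros z k Hz. apply Rdiv_le_0_compat; [lra|]. apply pow_lt; lra. }
assert (WS : forall z k, z / 2 ^ S k = z / 2 ^ k / 2).
{ intros z k. simpl. field. apply pow_nonzero; lra. }
set (good := fun (k : nat) (p : R * R) => a <= fst p /\ fst p + w / 2 ^ k <= a + w /\
   c <= snd p /\ snd p + h / 2 ^ k <= c + h).
(* The premise [good k p] stands under the existential so that choice gives a successor map defined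
   on all pairs; the premise is discharged along the sequence by [G]. *)
assert (step : forall (k : nat) (p : R * R), exists q : R * R, good k p ->
  (fst q = fst p \/ fst q = fst p + w / 2 ^ k / 2) /\
  (snd q = snd p \/ snd q = snd p + h / 2 ^ k / 2) /\ I p k <= 4 * I q (S k)).
{ intros k p.
  destruct (classic (good k p)) as [G|G]; [|exists p; tauto].
  destruct G as (G1 & G2 & G3 & G4).
  assert (E := circulation_quarters P Q (fst p) (snd p) (w / 2 ^ k) (h / 2 ^ k)
    (W w k Hw) (W h k Hh) ltac:(intros; apply Hcl; lra)).
  set (x := fst p) in *. set (y := snd p) in *.
  set (x' := x + w / 2 ^ k / 2) in *. set (y' := y + h / 2 ^ k / 2) in *.
  assert (T : I p k <= I (x, y) (S k) + I (x', y) (S k) + I (x, y') (S k) + I (x', y') (S k)).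
  { unfold I. simpl fst. simpl snd. rewrite !WS. fold x y. rewrite E.
    eapply Rle_trans; [apply Rabs_triang|]. apply Rplus_le_compat_r.
    eapply Rle_trans; [apply Rabs_triang|]. apply Rplus_le_compat_r.
    apply Rabs_triang. }
  destruct (Rle_dec (I p k) (4 * I (x, y) (S k))). { exists (x, y); simpl; auto. }
  destruct (Rle_dec (I p k) (4 * I (x', y) (S k))). { exists (x', y); simpl; auto. }
  destruct (Rle_dec (I p k) (4 * I (x, y') (S k))). { exists (x, y'); simpl; auto. }
  exists (x', y'). intros _. simpl. split; [auto|]. split; [auto|]. lra. }
assert (exists nxt : nat * (R * R) -> R * R, forall kp, good (fst kp) (snd kp) ->
  (fst (nxt kp) = fst (snd kp) \/ fst (nxt kp) = fst (snd kp) + w / 2 ^ fst kp / 2) /\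
  (snd (nxt kp) = snd (snd kp) \/ snd (nxt kp) = snd (snd kp) + h / 2 ^ fst kp / 2) /\
  I (snd kp) (fst kp) <= 4 * I (nxt kp) (S (fst kp))) as [nxt Hn].
{ exists (fun kp => proj1_sig (constructive_indefinite_description _ (step (fst kp) (snd kp)))).
  intros kp.
  exact (proj2_sig (constructive_indefinite_description _ (step (fst kp) (snd kp)))). }
set (p := fix p k := match k with O => (a, c) | S k' => nxt (k', p k') end).
assert (G : forall k, good k (p k)).
{ induction k as [|k IH].
  - unfold good. simpl. lra.
  - destruct (Hn (k, p k) IH) as (H1 & H2 & _). simpl fst in *. simpl snd in *.
    change (p (S k)) with (nxt (k, p k)). unfold good in *. rewrite !WS.
    assert (W1 := W w k Hw). assert (W2 := W h k Hh).
    destruct H1 as [->| ->]; destruct H2 as [->| ->]; lra. }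
assert (HS : forall k, (fst (p (S k)) = fst (p k) \/ fst (p (S k)) = fst (p k) + w / 2 ^ k / 2) /\
  (snd (p (S k)) = snd (p k) \/ snd (p (S k)) = snd (p k) + h / 2 ^ k / 2) /\
   I (p k) k <= 4 * I (p (S k)) (S k)).
{ intros k. exact (Hn (k, p k) (G k)). }
assert (L : forall k, I (a, c) O <= 4 ^ k * I (p k) k).
{ induction k as [|k IH]; [simpl; lra|].
  destruct (HS k) as (_ & _ & H3). simpl pow.
  assert (0 < 4 ^ k) by (apply pow_lt; lra).
  assert (4 ^ k * I (p k) k <= 4 ^ k * (4 * I (p (S k)) (S k))) by (apply Rmult_le_compat_l; lra).
  lra. }
destruct (halving_limit (fun k => fst (p k)) w Hw (fun k => proj1 (HS k))) as [x Hx].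
destruct (halving_limit (fun k => snd (p k)) h Hh (fun k => proj1 (proj2 (HS k)))) as [y Hy].
assert (Hcl0 : closed_form_at P Q x y).
{ specialize (Hx O). specialize (Hy O). simpl in Hx, Hy. apply Hcl; lra. }
(* After N subdivisions the bound near the limit point has shrunk by 4^N, exactly the factor lost in
   choosing quarters. The [+ 1] in the denominator below covers a degenerate rectangle with w = h =
   0. *)
assert (Main : forall eps : posreal, I (a, c) O <= eps * (2 * (w + h) ^ 2)).
{ intros eps. destruct (circulation_near_point P Q x y eps Hcl0) as (d & Hd & D).
  destruct (pow_lt_1_zero (/ 2) ltac:(rewrite Rabs_right; lra) (d / (w + h + 1))
    ltac:(apply Rdiv_lt_0_compat; lra)) as [N HN].
  specialize (HN N (le_n N)).
  assert (P2 : 0 < 2 ^ N) by (apply pow_lt; lra).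
  rewrite pow_inv, Rabs_right in HN by (apply Rle_ge, Rlt_le, Rinv_0_lt_compat; lra).
  assert (small : (w + h + 1) / 2 ^ N < d).
  { apply Rmult_lt_reg_r with (/ (w + h + 1)). { apply Rinv_0_lt_compat; lra. }
    replace ((w + h + 1) / 2 ^ N * / (w + h + 1)) with (/ 2 ^ N) by (field; lra).
    exact HN. }
  assert (i2 : 0 < / 2 ^ N) by (apply Rinv_0_lt_compat; lra).
  assert (W1 := W w N Hw). assert (W2 := W h N Hh).
  unfold Rdiv in small. rewrite !Rmult_plus_distr_r in small.
  destruct (G N) as (G1 & G2 & G3 & G4).
  assert (E := D (fst (p N)) (snd (p N)) (w / 2 ^ N) (h / 2 ^ N)
     ltac:(unfold Rdiv in *; lra) ltac:(unfold Rdiv in *; lra)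
     ltac:(intros; apply Hcl; lra) (Hx N) (Hy N)).
  fold (I (p N) N) in E.
  assert (P4 : 4 ^ N = 2 ^ N * 2 ^ N). { rewrite <- Rpow_mult_distr. f_equal. }
  eapply Rle_trans; [apply (L N)|].
  apply Rle_trans with (4 ^ N * (eps * (2 * (w / 2 ^ N + h / 2 ^ N) ^ 2))).
  { apply Rmult_le_compat_l; [apply pow_le; lra | exact E]. }
  rewrite P4. right. field. lra. }
assert (Z : I (a, c) O <= 0).
{ apply Rnot_lt_le. intros Hpos.
  set (b := 2 * (w + h) ^ 2) in *.
  assert (Hb : 0 <= b). { unfold b. assert (0 <= (w + h) ^ 2) by (apply pow_le; lra). lra. }
  assert (He : 0 < I (a, c) O / (2 * (b + 1))) by (apply Rdiv_lt_0_compat; lra).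
  assert (T := Main (mkposreal _ He)). simpl in T.
  assert (I (a, c) O / (2 * (b + 1)) * b <= I (a, c) O / 2).
  { replace (I (a, c) O / 2) with (I (a, c) O / (2 * (b + 1)) * (b + 1)) by (field; lra).
    apply Rmult_le_compat_l; lra. }
  lra. }
unfold I in Z. simpl in Z. rewrite !Rdiv_1_r in Z.
assert (T := Rabs_pos (circulation P Q a c w h)).
apply Rabs_eq_0. lra.
Qed.

(** * Real and complex differentiability *)

(* Real Frechet differentiability of a map R^2 = C -> C, with partial derivatives [gx], [gy]. *)
Definition rdiff (G : C -> C) (p gx gy : C) : Prop :=
  forall eps, 0 < eps -> exists d, 0 < d /\ forall q, Cmod (q - p) < d ->
    Cmod (G q - G p - (RtoC (Re (q - p)) * gx + RtoC (Im (q - p)) * gy)) <= eps * Cmod (q - p).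

(** The Cauchy-Riemann equations in the form f_y = i f_x. With this encoding the rules for [rdiff]
    serve real and complex differentiability alike. *)
Definition cdiff (f : C -> C) (p l : C) : Prop := rdiff f p l (Ci * l)%C.

Lemma cdiffE (f : C -> C) (p l : C) :
  cdiff f p l <-> forall eps, 0 < eps -> exists d, 0 < d /\ forall q, Cmod (q - p) < d ->
    Cmod (f q - f p - (q - p) * l) <= eps * Cmod (q - p).
Proof.
assert (E : forall q, (RtoC (Re (q - p)) * l + RtoC (Im (q - p)) * (Ci * l) = (q - p) * l)%C).
{ intros q. destruct (q - p)%C as [a b]. destruct l as [l1 l2].
  unfold Cmult, Cplus, RtoC, Ci; simpl. f_equal; ring. }
unfold cdiff, rdiff.
split; intros H eps He; destruct (H eps He) as (d & Hd & D); exists d; split; auto;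
intros q Hq; specialize (D q Hq); rewrite E in *; exact D.
Qed.

Lemma cdiff_is_derive (f : C -> C) (p l : C) :
  is_derive (K := C_AbsRing) (V := C_NormedModule) f p l -> cdiff f p l.
Proof.
intros [_ H]. apply cdiffE. intros eps He.
destruct (H p (fun P HP => HP) (mkposreal _ He)) as [d D].
exists d. split; [apply cond_pos|]. intros q Hq. exact (D q Hq).
Qed.

Lemma rdiff_ext_loc (F G : C -> C) (p gx gy : C) (r : R) :
  0 < r -> (forall q, Cmod (q - p) < r -> F q = G q) -> rdiff F p gx gy -> rdiff G p gx gy.
Proof.
intros Hr E H eps He. destruct (H eps He) as (d & Hd & D).
exists (Rmin d r). split; [apply Rmin_glb_lt; lra|]. intros q Hq.
assert (M1 := Rmin_l d r). assert (M2 := Rmin_r d r).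
rewrite <- (E q) by lra. rewrite <- (E p). { apply D. lra. }
replace (p - p)%C with (RtoC 0) by ring. rewrite Cmod_0. exact Hr.
Qed.

Lemma re_im_bound (z : C) : Rabs (Re z) <= Cmod z /\ Rabs (Im z) <= Cmod z.
Proof.
assert (H := Rmax_Cmod z). assert (A := Rmax_l (Rabs (fst z)) (Rabs (snd z))).
assert (B := Rmax_r (Rabs (fst z)) (Rabs (snd z))). unfold Re, Im. lra.
Qed.

Lemma Cmod_le_re_im (z : C) : Cmod z <= Rabs (Re z) + Rabs (Im z).
Proof.
replace z with (RtoC (Re z) + Ci * RtoC (Im z))%C at 1.
2:{ destruct z. unfold Cmult, Cplus, RtoC, Ci; simpl. f_equal; ring. }
eapply Rle_trans; [apply Cmod_triangle|]. rewrite Cmod_mult, Cmod_Ci, !Cmod_R. lra.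
Qed.

Lemma linear_part_bound (q gx gy : C) :
  Cmod (RtoC (Re q) * gx + RtoC (Im q) * gy) <= (Cmod gx + Cmod gy) * Cmod q.
Proof.
eapply Rle_trans; [apply Cmod_triangle|]. rewrite !Cmod_mult, !Cmod_R.
destruct (re_im_bound q). assert (A := Cmod_ge_0 gx). assert (B := Cmod_ge_0 gy).
assert (Rabs (Re q) * Cmod gx <= Cmod q * Cmod gx) by (apply Rmult_le_compat_r; auto).
assert (Rabs (Im q) * Cmod gy <= Cmod q * Cmod gy) by (apply Rmult_le_compat_r; auto).
lra.
Qed.

Lemma rdiff_lipschitz (G : C -> C) (p gx gy : C) :
  rdiff G p gx gy -> exists M d, 0 < M /\ 0 < d /\
    forall q, Cmod (q - p) < d -> Cmod (G q - G p) <= M * Cmod (q - p).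
Proof.
intros H. destruct (H 1 Rlt_0_1) as (d & Hd & D).
exists (Cmod gx + Cmod gy + 1), d.
assert (A := Cmod_ge_0 gx). assert (B := Cmod_ge_0 gy).
split; [lra|]. split; [exact Hd|]. intros q Hq. specialize (D q Hq).
assert (E := linear_part_bound (q - p) gx gy).
replace (G q - G p)%C with ((G q - G p - (RtoC (Re (q - p)) * gx + RtoC (Im (q - p)) * gy))
  + (RtoC (Re (q - p)) * gx + RtoC (Im (q - p)) * gy))%C by ring.
eapply Rle_trans; [apply Cmod_triangle|]. lra.
Qed.

Lemma rdiff_const (c p : C) : rdiff (fun _ => c) p 0 0.
Proof.
intros eps He. exists 1. split; [lra|]. intros q _.
replace (c - c - _)%C with (RtoC 0) by ring. rewrite Cmod_0.
apply Rmult_le_pos; [lra | apply Cmod_ge_0].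
Qed.

Lemma rdiff_plus (F G : C -> C) (p fx fy gx gy : C) :
  rdiff F p fx fy -> rdiff G p gx gy -> rdiff (fun q => F q + G q)%C p (fx + gx)%C (fy + gy)%C.
Proof.
intros HF HG eps He.
destruct (HF (eps / 2) ltac:(lra)) as (d1 & P1 & D1).
destruct (HG (eps / 2) ltac:(lra)) as (d2 & P2 & D2).
exists (Rmin d1 d2). split; [apply Rmin_glb_lt; lra|]. intros q Hq.
assert (M1 := Rmin_l d1 d2). assert (M2 := Rmin_r d1 d2).
specialize (D1 q ltac:(lra)). specialize (D2 q ltac:(lra)).
set (s := RtoC (Re (q - p))) in *. set (t := RtoC (Im (q - p))) in *.
replace (F q + G q - (F p + G p) - (s * (fx + gx) + t * (fy + gy)))%C
  with ((F q - F p - (s * fx + t * fy)) + (G q - G p - (s * gx + t * gy)))%C by ring.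
eapply Rle_trans; [apply Cmod_triangle|]. lra.
Qed.

Lemma rdiff_comp (F G : C -> C) (p gx gy l : C) :
  rdiff G p gx gy -> cdiff F (G p) l -> rdiff (fun q => F (G q)) p (l * gx)%C (l * gy)%C.
Proof.
intros HG HF eps He. rewrite cdiffE in HF.
destruct (rdiff_lipschitz _ _ _ _ HG) as (M & d0 & HM & Hd0 & D0).
destruct (HF (eps / (2 * M)) ltac:(apply Rdiv_lt_0_compat; lra)) as (d1 & P1 & D1).
assert (L0 := Cmod_ge_0 l).
destruct (HG (eps / (2 * (Cmod l + 1))) ltac:(apply Rdiv_lt_0_compat; lra)) as (d2 & P2 & D2).
assert (P3 : 0 < d1 / M) by (apply Rdiv_lt_0_compat; lra).
exists (Rmin d0 (Rmin (d1 / M) d2)).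
split; [repeat apply Rmin_glb_lt; lra|]. intros q Hq.
assert (M1 := Rmin_l d0 (Rmin (d1 / M) d2)). assert (M2 := Rmin_r d0 (Rmin (d1 / M) d2)).
assert (M3 := Rmin_l (d1 / M) d2). assert (M4 := Rmin_r (d1 / M) d2).
specialize (D0 q ltac:(lra)). specialize (D2 q ltac:(lra)).
assert (Q0 := Cmod_ge_0 (q - p)).
assert (Hlt : Cmod (G q - G p) < d1).
{ eapply Rle_lt_trans; [exact D0|].
  replace d1 with (M * (d1 / M)) by (field; lra). apply Rmult_lt_compat_l; lra. }
specialize (D1 (G q) Hlt).
set (s := RtoC (Re (q - p))) in *. set (t := RtoC (Im (q - p))) in *.
replace (F (G q) - F (G p) - (s * (l * gx) + t * (l * gy)))%C
  with ((F (G q) - F (G p) - (G q - G p) * l) + l * (G q - G p - (s * gx + t * gy)))%C by ring.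
eapply Rle_trans; [apply Cmod_triangle|]. rewrite Cmod_mult.
assert (T1 : eps / (2 * M) * Cmod (G q - G p) <= eps / (2 * M) * (M * Cmod (q - p))).
{ apply Rmult_le_compat_l; [|exact D0]. apply Rlt_le, Rdiv_lt_0_compat; lra. }
replace (eps / (2 * M) * (M * Cmod (q - p))) with (eps / 2 * Cmod (q - p)) in T1 by (field; lra).
set (Y := Cmod (G q - G p - (s * gx + t * gy))) in *.
assert (T2 : Cmod l * Y <= (Cmod l + 1) * (eps / (2 * (Cmod l + 1)) * Cmod (q - p))).
{ apply Rmult_le_compat; try lra. apply Cmod_ge_0. }
replace ((Cmod l + 1) * (eps / (2 * (Cmod l + 1)) * Cmod (q - p)))
  with (eps / 2 * Cmod (q - p)) in T2 by (field; lra).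
lra.
Qed.

Lemma cdiff_square_bound (f : C -> C) (p l : C) (B r : R) :
  0 < r ->
  (forall q, Cmod (q - p) < r -> Cmod (f q - f p - (q - p) * l) <= B * Cmod (q - p) ^ 2) ->
  cdiff f p l.
Proof.
intros Hr H. apply cdiffE. intros eps He.
set (B' := Rabs B + 1). assert (HB : 0 < B') by (unfold B'; assert (T := Rabs_pos B); lra).
assert (P : 0 < eps / B') by (apply Rdiv_lt_0_compat; lra).
exists (Rmin r (eps / B')). split; [apply Rmin_glb_lt; lra|].
intros q Hq. assert (M1 := Rmin_l r (eps / B')). assert (M2 := Rmin_r r (eps / B')).
eapply Rle_trans; [apply H; lra|].
assert (Q0 := Cmod_ge_0 (q - p)).
replace (B * Cmod (q - p) ^ 2) with (B * Cmod (q - p) * Cmod (q - p)) by ring.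
apply Rmult_le_compat_r; [exact Q0|].
apply Rle_trans with (B' * Cmod (q - p)).
{ apply Rmult_le_compat_r; [exact Q0|]. unfold B'. assert (T := Rle_abs B). lra. }
replace eps with (B' * (eps / B')) by (field; lra). apply Rmult_le_compat_l; lra.
Qed.

Lemma cdiff_scal (c p : C) : cdiff (fun q => c * q)%C p c.
Proof.
apply cdiff_square_bound with 0 1; [lra|]. intros q _.
replace (c * q - c * p - (q - p) * c)%C with (RtoC 0) by ring. rewrite Cmod_0. lra.
Qed.

Lemma cdiff_sqr (p : C) : cdiff (fun q => q * q)%C p (2 * p)%C.
Proof.
apply cdiff_square_bound with 1 1; [lra|]. intros q _.
replace (q * q - p * p - (q - p) * (2 * p))%C with ((q - p) * (q - p))%C by ring.
rewrite Cmod_mult. lra.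
Qed.

Lemma Cmod_lower (w q p : C) : Cmod (w - p) - Cmod (q - p) <= Cmod (w - q).
Proof.
assert (T := Cmod_triangle (w - q) (q - p)).
replace (w - q + (q - p))%C with (w - p)%C in T by ring. lra.
Qed.

Lemma Cinv_sub_bound (w q p : C) (d : R) :
  0 < d -> d <= Cmod (w - p) -> Cmod (q - p) < d / 2 ->
  (w - p)%C <> 0 /\ (w - q)%C <> 0 /\
  Cmod (/ (w - p)) <= 2 / d /\ Cmod (/ (w - q)) <= 2 / d.
Proof.
intros Hd H1 H2. assert (L := Cmod_lower w q p).
assert (N1 : (w - p)%C <> 0) by (apply Cmod_gt_0; lra).
assert (N2 : (w - q)%C <> 0) by (apply Cmod_gt_0; lra).
repeat split; auto; rewrite Cmod_inv by auto;
replace (2 / d) with (/ (d / 2)) by (field; lra); apply Rinv_le_contravar; lra.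
Qed.

Lemma cdiff_inv (p : C) : p <> 0 -> cdiff Cinv p (- (/ (p * p)))%C.
Proof.
intros Hp. assert (Hd : 0 < Cmod p) by (apply Cmod_gt_0; exact Hp).
apply cdiff_square_bound with ((2 / Cmod p) * (2 / Cmod p) * (2 / Cmod p)) (Cmod p / 2); [lra|].
intros q Hq.
destruct (Cinv_sub_bound 0 (- q) (- p) (Cmod p) Hd) as (N1 & N2 & B1 & B2).
{ right. f_equal. ring. }
{ replace (- q - - p)%C with (- (q - p))%C by ring. rewrite Cmod_opp. exact Hq. }
replace (0 - - p)%C with p in * by ring. replace (0 - - q)%C with q in * by ring.
replace (/ q - / p - (q - p) * (- (/ (p * p))))%C
  with (/ p * / p * / q * ((q - p) * (q - p)))%C by (field; auto).
rewrite !Cmod_mult.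
assert (I1 := Cmod_ge_0 (/ p)). assert (I2 := Cmod_ge_0 (/ q)).
replace (Cmod (q - p) ^ 2) with (Cmod (q - p) * Cmod (q - p)) by ring.
apply Rmult_le_compat_r. { apply Rmult_le_pos; apply Cmod_ge_0. }
repeat apply Rmult_le_compat; try lra. apply Rmult_le_pos; lra.
Qed.

(* Polarization reduces products to [rdiff_comp] with the square. *)
Lemma rdiff_mult (F G : C -> C) (p fx fy gx gy : C) :
  rdiff F p fx fy -> rdiff G p gx gy ->
  rdiff (fun q => F q * G q)%C p (fx * G p + F p * gx)%C (fy * G p + F p * gy)%C.
Proof.
intros HF HG.
assert (S := rdiff_comp _ _ _ _ _ _ (rdiff_plus _ _ _ _ _ _ _ HF HG) (cdiff_sqr _)).
assert (HN := rdiff_comp _ _ _ _ _ _ HG (cdiff_scal (- (1)) _)). simpl in HN.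
assert (D := rdiff_comp _ _ _ _ _ _ (rdiff_plus _ _ _ _ _ _ _ HF HN) (cdiff_sqr _)).
assert (D' := rdiff_comp _ _ _ _ _ _ D (cdiff_scal (- / 4) _)).
assert (S' := rdiff_comp _ _ _ _ _ _ S (cdiff_scal (/ 4) _)).
assert (T := rdiff_plus _ _ _ _ _ _ _ S' D'). cbv beta in T.
match type of T with rdiff _ _ ?x ?y =>
  replace x with (fx * G p + F p * gx)%C in T by field;
  replace y with (fy * G p + F p * gy)%C in T by field end.
apply (rdiff_ext_loc _ _ _ _ _ 1 Rlt_0_1) with (2 := T).
intros q _. field.
Qed.

Lemma rdiff_fst (p : C) : rdiff (fun q => RtoC (Re q)) p 1 0.
Proof.
intros eps He. exists 1. split; [lra|]. intros [q1 q2] _. destruct p as [p1 p2].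
match goal with |- Cmod ?x <= _ => replace x with (RtoC 0) end.
- rewrite Cmod_0. apply Rmult_le_pos; [lra | apply Cmod_ge_0].
- unfold Cmult, Cplus, Cminus, Copp, RtoC; simpl. apply injective_projections; simpl; ring.
Qed.

Lemma is_derive_eps (f : R -> R) (x l : R) : is_derive f x l ->
  forall eps, 0 < eps -> exists d, 0 < d /\ forall y, Rabs (y - x) < d ->
    Rabs (f y - f x - (y - x) * l) <= eps * Rabs (y - x).
Proof.
intros [_ H] eps He.
destruct (H x (fun P HP => HP) (mkposreal _ He)) as [d D].
exists d. split; [apply cond_pos|]. intros y Hy. exact (D y Hy).
Qed.

Lemma rdiff_snd (f g : R -> R) (p : C) (lf lg : R) :
  is_derive f (Im p) lf -> is_derive g (Im p) lg ->
  rdiff (fun q => (f (Im q), g (Im q))) p 0 (lf, lg).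
Proof.
intros Hf Hg eps He.
destruct (is_derive_eps _ _ _ Hf (eps / 2) ltac:(lra)) as (d1 & P1 & D1).
destruct (is_derive_eps _ _ _ Hg (eps / 2) ltac:(lra)) as (d2 & P2 & D2).
exists (Rmin d1 d2). split; [apply Rmin_glb_lt; lra|]. intros q Hq.
assert (M1 := Rmin_l d1 d2). assert (M2 := Rmin_r d1 d2).
destruct (re_im_bound (q - p)) as [_ B].
assert (EI : Im (q - p) = Im q - Im p) by reflexivity. rewrite EI in *.
specialize (D1 (Im q) ltac:(lra)). specialize (D2 (Im q) ltac:(lra)).
eapply Rle_trans; [apply Cmod_le_re_im|].
match goal with |- Rabs ?x + Rabs ?y <= _ =>
  replace x with (f (Im q) - f (Im p) - (Im q - Im p) * lf);
  [replace y with (g (Im q) - g (Im p) - (Im q - Im p) * lg)|] end.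
- assert (eps / 2 * Rabs (Im q - Im p) <= eps / 2 * Cmod (q - p)) by (apply Rmult_le_compat_l; lra).
  lra.
- unfold Cmult, Cplus, Cminus, Copp, RtoC, Im; simpl. ring.
- unfold Cmult, Cplus, Cminus, Copp, RtoC, Im; simpl. ring.
Qed.

Lemma rdiff_components (G : C -> C) (p gx gy : C) : rdiff G p gx gy ->
  differentiable_pt_lim (fun x y => Re (G (x, y))) (Re p) (Im p) (Re gx) (Re gy) /\
  differentiable_pt_lim (fun x y => Im (G (x, y))) (Re p) (Im p) (Im gx) (Im gy).
Proof.
intros H.
assert (K : forall eps : posreal, exists d : posreal, forall x y,
  Rabs (x - Re p) < d -> Rabs (y - Im p) < d ->
  Cmod (G (x, y) - G p - (RtoC (x - Re p) * gx + RtoC (y - Im p) * gy))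
    <= eps * Rmax (Rabs (x - Re p)) (Rabs (y - Im p))).
{ intros eps. destruct (H (eps / 2) ltac:(assert (T := cond_pos eps); lra)) as (d & Hd & D).
  assert (Hd2 : 0 < d / 2) by lra.
  exists (mkposreal _ Hd2). simpl. intros x y Hx Hy.
  assert (B := Cmod_le_re_im ((x, y) - p)).
  change (Re ((x, y) - p)) with (x - Re p) in B. change (Im ((x, y) - p)) with (y - Im p) in B.
  assert (E0 := cond_pos eps).
  eapply Rle_trans; [apply (D (x, y)); lra|].
  apply Rle_trans with (eps / 2 * (2 * Rmax (Rabs (x - Re p)) (Rabs (y - Im p)))); [|right; field].
  apply Rmult_le_compat_l; [lra|].
  assert (T1 := Rmax_l (Rabs (x - Re p)) (Rabs (y - Im p))).
  assert (T2 := Rmax_r (Rabs (x - Re p)) (Rabs (y - Im p))). lra. }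
destruct p as [p1 p2].
split; intros eps; destruct (K eps) as [d D]; exists d; intros x y Hx Hy;
(eapply Rle_trans; [|apply (D x y Hx Hy)]); destruct gx as [a b], gy as [a' b'].
- eapply Rle_trans; [|apply (proj1 (re_im_bound _))].
  right. f_equal. unfold Cmult, Cplus, Cminus, Copp, RtoC, Re, Im; simpl. ring.
- eapply Rle_trans; [|apply (proj2 (re_im_bound _))].
  right. f_equal. unfold Cmult, Cplus, Cminus, Copp, RtoC, Re, Im; simpl. ring.
Qed.

Lemma cdiff_unique (f : C -> C) (p l l' : C) : cdiff f p l -> cdiff f p l' -> l = l'.
Proof.
intros H H'. apply rdiff_components in H, H'.
destruct H as [H1 H2], H' as [H1' H2'].
apply differentiable_pt_lim_unique in H1, H2, H1', H2'.
destruct H1, H2, H1', H2'. apply injective_projections; unfold Re, Im in *; congruence.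
Qed.

(** * Cauchy's formula on a circle *)

Definition ccont (g : R -> C) (t : R) : Prop :=
  continuous (fun t => Re (g t)) t /\ continuous (fun t => Im (g t)) t.

Definition CI (g : R -> C) : C :=
  (RInt (fun t => Re (g t)) 0 (2 * PI), RInt (fun t => Im (g t)) 0 (2 * PI)).

Lemma two_PI_pos : 0 < 2 * PI.
Proof. assert (T := PI_RGT_0). lra. Qed.

Lemma rdiff_slice (G : C -> C) (x t : R) (gx gy : C) :
  rdiff G (x, t) gx gy -> ccont (fun s => G (x, s)) t.
Proof.
intros H. apply rdiff_components in H. destruct H as [H1 H2].
split; [apply (continuous_slices _ _ _ _ _ H1) | apply (continuous_slices _ _ _ _ _ H2)].
Qed.

Lemma ccont_ex_RInt (g : R -> C) : (forall t, ccont g t) ->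
  ex_RInt (fun t => Re (g t)) 0 (2 * PI) /\ ex_RInt (fun t => Im (g t)) 0 (2 * PI).
Proof.
intros H. assert (T := two_PI_pos).
split; apply ex_RInt_continuous_on; try lra; intros x _; apply H.
Qed.

Lemma CI_ext (g h : R -> C) : (forall t, g t = h t) -> CI g = CI h.
Proof.
intros H. unfold CI. f_equal; apply RInt_ext; intros t _; rewrite H; reflexivity.
Qed.

Lemma CI_minus (g h : R -> C) : (forall t, ccont g t) -> (forall t, ccont h t) ->
  CI (fun t => g t - h t)%C = (CI g - CI h)%C.
Proof.
intros Hg Hh. destruct (ccont_ex_RInt _ Hg) as [g1 g2]. destruct (ccont_ex_RInt _ Hh) as [h1 h2].
apply injective_projections.
- exact (RInt_minus (V := R_CompleteNormedModule) _ _ _ _ g1 h1).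
- exact (RInt_minus (V := R_CompleteNormedModule) _ _ _ _ g2 h2).
Qed.

Lemma CI_scal (c : C) (g : R -> C) : (forall t, ccont g t) ->
  CI (fun t => c * g t)%C = (c * CI g)%C.
Proof.
intros Hg. destruct (ccont_ex_RInt _ Hg) as [g1 g2].
assert (S1 := fun a => RInt_scal (V := R_CompleteNormedModule) _ _ _ a g1).
assert (S2 := fun a => RInt_scal (V := R_CompleteNormedModule) _ _ _ a g2).
assert (E1 := fun a => ex_RInt_scal (V := R_NormedModule) _ _ _ a g1).
assert (E2 := fun a => ex_RInt_scal (V := R_NormedModule) _ _ _ a g2).
destruct c as [a b]. apply injective_projections.
- etransitivity;
  [exact (RInt_minus (V := R_CompleteNormedModule) _ _ _ _ (E1 a) (E2 b))|].
  rewrite S1, S2. reflexivity.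
- etransitivity;
  [exact (RInt_plus (V := R_CompleteNormedModule) _ _ _ _ (E2 a) (E1 b))|].
  rewrite S1, S2. reflexivity.
Qed.

(** Real and imaginary parts are estimated separately, hence 4 PI instead of 2 PI; only linearity of
    the bound in [M] matters later. *)
Lemma CI_bound (g : R -> C) (M : R) : (forall t, ccont g t) ->
  (forall t, 0 <= t <= 2 * PI -> Cmod (g t) <= M) -> Cmod (CI g) <= M * (4 * PI).
Proof.
intros Hg HM. destruct (ccont_ex_RInt _ Hg) as [g1 g2]. assert (T := two_PI_pos).
rewrite <- (Rplus_0_l (2 * PI)) in g1, g2.
assert (B1 : Rabs (RInt (fun t => Re (g t)) 0 (0 + 2 * PI) - 0 * (2 * PI)) <= M * (2 * PI)).
{ apply RInt_near_const; [lra | exact g1 |]. intros t Ht. rewrite Rminus_0_r.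
  eapply Rle_trans; [apply re_im_bound | apply HM; lra]. }
assert (B2 : Rabs (RInt (fun t => Im (g t)) 0 (0 + 2 * PI) - 0 * (2 * PI)) <= M * (2 * PI)).
{ apply RInt_near_const; [lra | exact g2 |]. intros t Ht. rewrite Rminus_0_r.
  eapply Rle_trans; [apply (proj2 (re_im_bound _)) | apply HM; lra]. }
rewrite Rmult_0_l, Rminus_0_r, Rplus_0_l in B1, B2.
eapply Rle_trans; [apply Cmod_le_re_im|]. unfold CI, Re, Im in *. simpl fst. simpl snd. lra.
Qed.

Lemma ccont_bounded (g : R -> C) : (forall t, ccont g t) ->
  exists M, 0 <= M /\ forall t, 0 <= t <= 2 * PI -> Cmod (g t) <= M.
Proof.
intros Hg.
destruct (bounded_continuity (V := R_NormedModule) (fun t => Re (g t)) 0 (2 * PI)) as [M1 B1].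
{ intros x _. apply Hg. }
destruct (bounded_continuity (V := R_NormedModule) (fun t => Im (g t)) 0 (2 * PI)) as [M2 B2].
{ intros x _. apply Hg. }
assert (B : forall t, 0 <= t <= 2 * PI -> Cmod (g t) <= M1 + M2).
{ intros t Ht. specialize (B1 t Ht). specialize (B2 t Ht).
  change (@norm R_AbsRing R_NormedModule) with Rabs in B1, B2.
  assert (T := Cmod_le_re_im (g t)). lra. }
exists (M1 + M2). split; [|exact B].
eapply Rle_trans; [apply Cmod_ge_0|]. apply (B 0). assert (T := two_PI_pos). lra.
Qed.

Definition circ (rho t : R) : C := (rho * cos t, rho * sin t).

Lemma Cmod_circ (rho t : R) : 0 <= rho -> Cmod (circ rho t) = rho.
Proof.
intros Hr. unfold circ, Cmod. simpl fst. simpl snd.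
replace ((rho * cos t) ^ 2 + (rho * sin t) ^ 2) with (rho ^ 2 * ((sin t)² + (cos t)²))
  by (unfold Rsqr; ring).
rewrite sin2_cos2, Rmult_1_r. apply sqrt_pow2. exact Hr.
Qed.

Lemma circ_period (rho : R) : circ rho (2 * PI) = circ rho 0.
Proof. unfold circ. rewrite cos_2PI, sin_2PI, cos_0, sin_0. reflexivity. Qed.

Lemma rdiff_circ (rho : R) (p : C) :
  rdiff (fun q => circ rho (Im q)) p 0 (Ci * circ rho (Im p))%C.
Proof.
replace (Ci * circ rho (Im p))%C with ((- rho * sin (Im p), rho * cos (Im p)) : C).
- apply (rdiff_snd (fun t => rho * cos t) (fun t => rho * sin t));
  auto_derive; trivial; ring.
- unfold circ, Ci, Cmult; simpl. apply injective_projections; simpl; ring.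
Qed.

Lemma circ_sub_neq0 (rho t : R) (z : C) : Cmod z < rho -> (circ rho t - z)%C <> 0.
Proof.
intros Hz. apply Cmod_gt_0.
assert (Z0 := Cmod_ge_0 z).
assert (L := Cmod_lower (circ rho t) z 0).
replace (circ rho t - 0)%C with (circ rho t) in L by ring.
replace (z - 0)%C with z in L by ring.
rewrite Cmod_circ in L by lra. lra.
Qed.

Lemma rdiff_minus_const (F : C -> C) (c p fx fy : C) :
  rdiff F p fx fy -> rdiff (fun q => F q - c)%C p fx fy.
Proof.
intros H. assert (T := rdiff_plus _ _ _ _ _ _ _ H (rdiff_const (- c)%C p)).
rewrite !Cplus_0_r in T. exact T.
Qed.

Lemma rdiff_cauchy_kernel (rho : R) (z p : C) : Cmod z < rho ->
  exists gy, rdiff (fun q => / (circ rho (Im q) - z))%C p 0 gy.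
Proof.
intros Hz. eexists.
rewrite <- (Cmult_0_r (- / ((circ rho (Im p) - z) * (circ rho (Im p) - z)))).
apply (rdiff_comp Cinv).
- apply rdiff_minus_const. apply rdiff_circ.
- apply cdiff_inv. apply circ_sub_neq0. exact Hz.
Qed.

(* The form ((f w - f z) / (w - z)) dw is pulled back to the rectangle by
   (lam, theta) |-> z + lam (circ rho theta - z), so that Goursat on [e, 1] x [0, 2 PI]
   contracts the circle to the point z. *)
Theorem cauchy_circle (f : C -> C) (rho : R) (z : C) :
  Cmod z < rho -> (forall w, Cmod w <= rho -> exists l, cdiff f w l) ->
  CI (fun t => (f (circ rho t) - f z) * (Ci * circ rho t * / (circ rho t - z)))%C = 0.
Proof.
intros Hz Hf. assert (Z0 := Cmod_ge_0 z).
set (W := fun q : C => (z + RtoC (Re q) * (circ rho (Im q) - z))%C).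
set (c := fun t => (Ci * circ rho t * / (circ rho t - z))%C).
set (P := fun q : C => ((f (W q) - f z) * / RtoC (Re q))%C).
set (Q := fun q : C => ((f (W q) - f z) * c (Im q))%C).
assert (HW : forall p, rdiff W p (circ rho (Im p) - z)%C (RtoC (Re p) * (Ci * circ rho (Im p)))%C).
{ intros p.
  assert (A := rdiff_minus_const _ z _ _ _ (rdiff_circ rho p)).
  assert (B := rdiff_mult _ _ _ _ _ _ _ (rdiff_fst p) A). cbv beta in B.
  assert (D := rdiff_plus _ _ _ _ _ _ _ (rdiff_const z p) B). unfold W.
  match type of D with rdiff _ _ ?x ?y =>
    replace (circ rho (Im p) - z)%C with x by ring;
    replace (RtoC (Re p) * (Ci * circ rho (Im p)))%C with y by ring end.
  exact D. }
assert (Hc : forall p, exists cy, rdiff (fun q => c (Im q)) p 0 cy).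
{ intros p. destruct (rdiff_cauchy_kernel rho z p Hz) as [ky K].
  assert (A := rdiff_comp _ _ _ _ _ _ (rdiff_circ rho p) (cdiff_scal Ci _)).
  assert (B := rdiff_mult _ _ _ _ _ _ _ A K). cbv beta in B. eexists.
  match type of B with rdiff _ _ ?x _ => replace x with (RtoC 0) in B by ring end.
  exact B. }
assert (Win : forall p, 0 < Re p <= 1 -> Cmod (W p) <= rho).
{ intros [x y] Hx. unfold W. simpl Re in *. simpl Im.
  replace (z + RtoC x * (circ rho y - z))%C with (RtoC (1 - x) * z + RtoC x * circ rho y)%C
    by (rewrite RtoC_minus; ring).
  eapply Rle_trans; [apply Cmod_triangle|].
  rewrite !Cmod_mult, !Cmod_R, Cmod_circ, !Rabs_right by lra.
  assert ((1 - x) * Cmod z <= (1 - x) * rho) by (apply Rmult_le_compat_l; lra). lra. }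
assert (HPQ : forall p, 0 < Re p <= 1 -> exists px k qy, rdiff P p px k /\ rdiff Q p k qy).
{ intros p Hp. destruct (Hf (W p) (Win p Hp)) as [l Hl].
  assert (A := rdiff_minus_const _ (f z) _ _ _ (rdiff_comp _ _ _ _ _ _ (HW p) Hl)).
  assert (Np : RtoC (Re p) <> 0). { intros E. apply RtoC_inj in E. lra. }
  assert (B := rdiff_comp _ _ _ _ _ _ (rdiff_fst p) (cdiff_inv _ Np)).
  assert (HP := rdiff_mult _ _ _ _ _ _ _ A B). cbv beta in HP.
  destruct (Hc p) as [cy C1].
  assert (HQ := rdiff_mult _ _ _ _ _ _ _ A C1). cbv beta in HQ.
  assert (N := circ_sub_neq0 rho (Im p) z Hz).
  (* The two mixed partial derivatives agree: the factor lam in the theta-derivative of [W] cancels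
     the denominator of [P], and the factor w - z in the lam-derivative of [W] cancels that of
     [c]. *)
  exists (l * (circ rho (Im p) - z) * / RtoC (Re p) + (f (W p) - f z) *
     (- / (RtoC (Re p) * RtoC (Re p)) * 1))%C, (l * (Ci * circ rho (Im p)))%C.
  eexists. split.
  - match type of HP with rdiff _ _ _ ?y =>
      replace y with (l * (Ci * circ rho (Im p)))%C in HP by (field; exact Np) end.
    exact HP.
  - match type of HQ with rdiff _ _ ?x _ =>
      replace x with (l * (Ci * circ rho (Im p)))%C in HQ by (unfold c; field; exact N) end.
    exact HQ. }
assert (Qc : forall e, 0 < e <= 1 -> forall t, ccont (fun s => Q (e, s)) t).
{ intros e He t. destruct (HPQ (e, t) He) as (px & k & qy & _ & H). apply (rdiff_slice _ _ _ _ _ H). }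
assert (CQ : forall e, 0 < e < 1 -> CI (fun t => Q (1, t)) = CI (fun t => Q (e, t))).
{ intros e He.
  assert (G1 := goursat (fun x y => Re (P (x, y))) (fun x y => Re (Q (x, y))) e 0 (1 - e) (2 * PI)
    ltac:(lra) (Rlt_le _ _ two_PI_pos)).
  assert (G2 := goursat (fun x y => Im (P (x, y))) (fun x y => Im (Q (x, y))) e 0 (1 - e) (2 * PI)
    ltac:(lra) (Rlt_le _ _ two_PI_pos)).
  unfold circulation in G1, G2. rewrite Rplus_0_l in G1, G2.
  replace (e + (1 - e)) with 1 in G1, G2 by ring.
  (* By periodicity the edges theta = 0 and theta = 2 PI cancel, so Goursat's theorem equates the
     integrals over the circles lam = e and lam = 1. *)
  assert (per : forall x, P (x, 2 * PI) = P (x, 0)).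
  { intros x. unfold P, W. simpl Im. rewrite circ_period. reflexivity. }
  rewrite (RInt_ext (fun x => Re (P (x, 2 * PI))) (fun x => Re (P (x, 0)))) in G1
    by (intros; rewrite per; reflexivity).
  rewrite (RInt_ext (fun x => Im (P (x, 2 * PI))) (fun x => Im (P (x, 0)))) in G2
    by (intros; rewrite per; reflexivity).
  unfold CI. f_equal.
  - assert (T : forall s t, e <= s <= 1 -> 0 <= t <= 2 * PI ->
      closed_form_at (fun x y => Re (P (x, y))) (fun x y => Re (Q (x, y))) s t).
    { intros s t Hs Ht. destruct (HPQ (s, t)) as (px & k & qy & H1 & H2). { simpl; lra. }
      apply rdiff_components in H1, H2. exists (Re px), (Re k), (Re qy).
      split; [apply H1 | apply H2]. }
    specialize (G1 T). lra.
  - assert (T : forall s t, e <= s <= 1 -> 0 <= t <= 2 * PI ->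
      closed_form_at (fun x y => Im (P (x, y))) (fun x y => Im (Q (x, y))) s t).
    { intros s t Hs Ht. destruct (HPQ (s, t)) as (px & k & qy & H1 & H2). { simpl; lra. }
      apply rdiff_components in H1, H2. exists (Im px), (Im k), (Im qy).
      split; [apply H1 | apply H2]. }
    specialize (G2 T). lra. }
transitivity (CI (fun t => Q (1, t))).
{ apply CI_ext. intros t. unfold Q, W, c. simpl Re. simpl Im.
  replace (z + 1 * (circ rho t - z))%C with (circ rho t) by ring. reflexivity. }
(* Subtracting f z pays off here: differentiability at z makes f (W) - f z of order e on the
   contracted circle, so an integral that does not depend on e is O(e), hence 0. *)
destruct (Hf z ltac:(lra)) as [lz Hlz].
destruct (rdiff_lipschitz _ _ _ _ Hlz) as (M & d & HM & Hd & D).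
destruct (ccont_bounded c) as (Mc & HMc & Bc).
{ intros t. destruct (Hc (0, t)) as [cy H]. apply (rdiff_slice (fun q => c (Im q)) 0 t _ _ H). }
set (K := M * (2 * rho) * Mc * (4 * PI)).
assert (B : forall e, 0 < e < 1 -> e * (2 * rho) < d -> Cmod (CI (fun t => Q (1, t))) <= K * e).
{ intros e He Hed. rewrite (CQ e He).
  replace (K * e) with (M * (e * (2 * rho)) * Mc * (4 * PI)) by (unfold K; ring).
  apply CI_bound; [apply Qc; lra|]. intros t Ht. unfold Q. rewrite Cmod_mult.
  assert (Wd : Cmod (W (e, t) - z) <= e * (2 * rho)).
  { unfold W. simpl Re. simpl Im.
    replace (z + e * (circ rho t - z) - z)%C with (e * (circ rho t - z))%C by ring.
    rewrite Cmod_mult, Cmod_R, Rabs_right by lra. apply Rmult_le_compat_l; [lra|].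
    unfold Cminus. eapply Rle_trans; [apply Cmod_triangle|]. rewrite Cmod_opp, Cmod_circ; lra. }
  apply Rmult_le_compat; try apply Cmod_ge_0; [|apply Bc; exact Ht].
  eapply Rle_trans; [apply D; lra|]. apply Rmult_le_compat_l; lra. }
apply Cmod_eq_0. apply Rle_antisym; [|apply Cmod_ge_0].
apply Rnot_lt_le. intros Hpos. set (X := Cmod (CI (fun t => Q (1, t)))) in *.
assert (HK : 0 <= K).
{ unfold K. assert (T := PI_RGT_0). apply Rmult_le_pos; [|lra]. apply Rmult_le_pos; [|lra].
  apply Rmult_le_pos; lra. }
(* The second entry keeps the contracted circle where the Lipschitz bound holds; the third gives K e
   <= X / 2, against X <= K e. [K + 1] avoids dividing by 0. *)
set (e := Rmin (/ 2) (Rmin (d / (4 * rho)) (X / (2 * (K + 1))))).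
assert (E1 := Rmin_l (/ 2) (Rmin (d / (4 * rho)) (X / (2 * (K + 1))))).
assert (E2 := Rmin_r (/ 2) (Rmin (d / (4 * rho)) (X / (2 * (K + 1))))).
assert (E3 := Rmin_l (d / (4 * rho)) (X / (2 * (K + 1)))).
assert (E4 := Rmin_r (d / (4 * rho)) (X / (2 * (K + 1)))).
fold e in E1, E2.
assert (0 < e).
{ unfold e. repeat apply Rmin_glb_lt; [lra | |]; apply Rdiv_lt_0_compat; lra. }
assert (T1 : e * (2 * rho) < d).
{ assert (e * (2 * rho) <= d / (4 * rho) * (2 * rho)) by (apply Rmult_le_compat_r; lra).
  replace (d / (4 * rho) * (2 * rho)) with (d / 2) in H0 by (field; lra). lra. }
assert (T2 := B e ltac:(lra) T1).
assert (K * e <= (K + 1) * (X / (2 * (K + 1)))) by (apply Rmult_le_compat; lra).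
replace ((K + 1) * (X / (2 * (K + 1)))) with (X / 2) in H0 by (field; lra). lra.
Qed.

(** * Complex derivatives and differentiation of Cauchy-type integrals *)

Lemma cdiff_mult (f g : C -> C) (p l m : C) :
  cdiff f p l -> cdiff g p m -> cdiff (fun q => f q * g q)%C p (l * g p + f p * m)%C.
Proof.
intros Hf Hg. assert (T := rdiff_mult _ _ _ _ _ _ _ Hf Hg). unfold cdiff.
replace (Ci * (l * g p + f p * m))%C with (Ci * l * g p + f p * (Ci * m))%C by ring.
exact T.
Qed.

Lemma cdiff_minus (f g : C -> C) (p l m : C) :
  cdiff f p l -> cdiff g p m -> cdiff (fun q => f q - g q)%C p (l - m)%C.
Proof.
intros Hf Hg.
assert (T := rdiff_plus _ _ _ _ _ _ _ Hf (rdiff_comp _ _ _ _ _ _ Hg (cdiff_scal (- (1)) _))).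
unfold cdiff.
replace (Ci * (l - m))%C with (Ci * l + - (1) * (Ci * m))%C by ring.
replace (l - m)%C with (l + - (1) * m)%C by ring.
apply (rdiff_ext_loc _ _ _ _ _ 1 Rlt_0_1) with (2 := T). intros q _. ring.
Qed.

Lemma cdiff_comp (f g : C -> C) (p l m : C) :
  cdiff g p m -> cdiff f (g p) l -> cdiff (fun q => f (g q)) p (l * m)%C.
Proof.
intros Hg Hf. assert (T := rdiff_comp _ _ _ _ _ _ Hg Hf). unfold cdiff.
replace (Ci * (l * m))%C with (l * (Ci * m))%C by ring. exact T.
Qed.

Lemma cdiff_ext_loc (f g : C -> C) (p l : C) (r : R) :
  0 < r -> (forall q, Cmod (q - p) < r -> f q = g q) -> cdiff f p l -> cdiff g p l.
Proof. apply rdiff_ext_loc. Qed.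

(** A function of the angle is read as a function on C that is constant in the real direction, so
    that the product and composition rules for [rdiff] yield its continuity. *)
Definition smooth_density (c : R -> C) : Prop :=
  forall p, exists gy, rdiff (fun q => c (Im q)) p 0 gy.

Lemma smooth_density_ccont (c : R -> C) : smooth_density c -> forall t, ccont c t.
Proof.
intros H t. destruct (H (0, t)) as [gy K]. apply (rdiff_slice (fun q => c (Im q)) 0 t _ _ K).
Qed.

Lemma smooth_density_mult (c d : R -> C) :
  smooth_density c -> smooth_density d -> smooth_density (fun t => c t * d t)%C.
Proof.
intros Hc Hd p. destruct (Hc p) as [y H]. destruct (Hd p) as [y' H'].
assert (T := rdiff_mult _ _ _ _ _ _ _ H H'). cbv beta in T. eexists.
match type of T with rdiff _ _ ?x _ => replace x with (RtoC 0) in T by ring end. exact T.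
Qed.

Lemma smooth_density_const (k : C) : smooth_density (fun _ => k).
Proof. intros p. exists 0. apply rdiff_const. Qed.

Lemma smooth_density_kernel (rho : R) (z : C) : Cmod z < rho ->
  smooth_density (fun t => / (circ rho t - z))%C.
Proof. intros Hz p. apply rdiff_cauchy_kernel. exact Hz. Qed.

Section Kernels.

Variables (rho : R) (c : R -> C).
Hypothesis Hc : smooth_density c.

Let a (z : C) (t : R) : C := (/ (circ rho t - z))%C.

Definition kernel1 (z : C) : C := CI (fun t => c t * (/ (circ rho t - z)))%C.
Definition kernel2 (z : C) : C :=
  CI (fun t => c t * (/ (circ rho t - z) * / (circ rho t - z)))%C.
Definition kernel3 (z : C) : C :=
  CI (fun t => c t * (2 * (/ (circ rho t - z) * (/ (circ rho t - z) * / (circ rho t - z)))))%C.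

(** Differentiation under the integral sign, reduced to a quadratic remainder uniform in t. The
    kernels are rational in z, so this remainder is an explicit product. *)
Lemma CI_cdiff (F : C -> R -> C) (dF : R -> C) (z : C) (B r : R) : 0 < r ->
  (forall q, Cmod (q - z) < r -> forall t, ccont (F q) t) ->
  (forall t, ccont dF t) ->
  (forall q, Cmod (q - z) < r -> forall t, 0 <= t <= 2 * PI ->
     Cmod (F q t - F z t - (q - z) * dF t) <= B * Cmod (q - z) ^ 2) ->
  cdiff (fun q => CI (F q)) z (CI dF).
Proof.
intros Hr HF HdF HB. apply cdiff_square_bound with (B * (4 * PI)) r; [exact Hr|].
intros q Hq.
assert (Hz : forall t, ccont (F z) t).
{ apply HF. replace (z - z)%C with (RtoC 0) by ring. rewrite Cmod_0. exact Hr. }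
assert (C1 : forall t, ccont (fun t => F q t - F z t)%C t).
{ intros t. destruct (HF q Hq t) as [x1 x2]. destruct (Hz t) as [y1 y2]. split.
  - exact (continuous_minus _ _ _ x1 y1).
  - exact (continuous_minus _ _ _ x2 y2). }
assert (C2 : forall t, ccont (fun t => (q - z) * dF t)%C t).
{ intros t. destruct (HdF t) as [x1 x2]. destruct (q - z)%C as [u w]. split.
  - exact (continuous_minus _ _ _ (continuous_scal_r u _ _ x1) (continuous_scal_r w _ _ x2)).
  - exact (continuous_plus _ _ _ (continuous_scal_r u _ _ x2) (continuous_scal_r w _ _ x1)). }
rewrite <- (CI_scal (q - z)) by exact HdF.
rewrite <- (CI_minus (F q)) by (auto; apply HF; exact Hq).
rewrite <- CI_minus by auto.
replace (B * (4 * PI) * Cmod (q - z) ^ 2) with (B * Cmod (q - z) ^ 2 * (4 * PI)) by ring.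
apply CI_bound.
- intros t. destruct (C1 t) as [x1 x2]. destruct (C2 t) as [y1 y2]. split.
  + exact (continuous_minus _ _ _ x1 y1).
  + exact (continuous_minus _ _ _ x2 y2).
- intros t Ht. apply HB; assumption.
Qed.

Lemma kernel_setup (z : C) : Cmod z < rho -> exists m r M, 0 < m /\ 0 < r /\ 0 <= M /\
  (forall t, 0 <= t <= 2 * PI -> Cmod (c t) <= M) /\
  (forall q, Cmod (q - z) < r -> Cmod q < rho /\ forall t,
     (circ rho t - z)%C <> 0 /\ (circ rho t - q)%C <> 0 /\
     Cmod (a z t) <= m /\ Cmod (a q t) <= m).
Proof.
intros Hz. assert (Z0 := Cmod_ge_0 z).
destruct (ccont_bounded c (smooth_density_ccont c Hc)) as (M & HM & B).
(* A point within half the gap rho - |z| of z keeps at least half that gap from the circle. *)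
exists (2 / (rho - Cmod z)), ((rho - Cmod z) / 2), M.
split; [apply Rdiv_lt_0_compat; lra|]. split; [lra|]. split; [exact HM|]. split; [exact B|].
intros q Hq. split.
- assert (T := Cmod_lower q z 0). replace (q - 0)%C with q in T by ring.
  replace (z - 0)%C with z in T by ring. lra.
- intros t. apply (Cinv_sub_bound (circ rho t) q z (rho - Cmod z)); [lra | | exact Hq].
  assert (T := Cmod_lower (circ rho t) z 0).
  replace (circ rho t - 0)%C with (circ rho t) in T by ring.
  replace (z - 0)%C with z in T by ring. rewrite Cmod_circ in T; lra.
Qed.

Lemma cdiff_kernel1 (z : C) : Cmod z < rho -> cdiff kernel1 z (kernel2 z).
Proof.
intros Hz. destruct (kernel_setup z Hz) as (m & r & M & Hm & Hr & HM & BM & H).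
apply (CI_cdiff (fun q t => c t * / (circ rho t - q))%C) with (M * (m * (m * m))) r; [exact Hr | | |].
- intros q Hq. apply smooth_density_ccont. apply smooth_density_mult; [exact Hc|].
  apply smooth_density_kernel. apply H. exact Hq.
- apply smooth_density_ccont. repeat apply smooth_density_mult; try exact Hc;
  apply smooth_density_kernel; exact Hz.
- intros q Hq t Ht. destruct (H q Hq) as [_ K]. destruct (K t) as (N1 & N2 & B1 & B2).
  (* With A = 1 / (w - z) and B = 1 / (w - q), the resolvent identity B - A = (q - z) A B used twice
     gives B - A - (q - z) A^2 = (q - z)^2 A^2 B. *)
  replace (c t * / (circ rho t - q) - c t * / (circ rho t - z)
     - (q - z) * (c t * (/ (circ rho t - z) * / (circ rho t - z))))%C
    with (c t * (a z t * (a z t * a q t)) * ((q - z) * (q - z)))%C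
    by (unfold a; field; split; assumption).
  rewrite !Cmod_mult. simpl pow. rewrite Rmult_1_r.
  apply Rmult_le_compat_r. { apply Rmult_le_pos; apply Cmod_ge_0. }
  repeat (apply Rmult_le_compat; try apply Cmod_ge_0;
    try (repeat apply Rmult_le_pos; apply Cmod_ge_0)); auto.
Qed.

Lemma cdiff_kernel2 (z : C) : Cmod z < rho -> cdiff kernel2 z (kernel3 z).
Proof.
intros Hz. destruct (kernel_setup z Hz) as (m & r & M & Hm & Hr & HM & BM & H).
apply (CI_cdiff (fun q t => c t * (/ (circ rho t - q) * / (circ rho t - q)))%C)
  with (M * (m * (m * (m * (3 * m))))) r; [exact Hr | | |].
- intros q Hq. apply smooth_density_ccont. repeat apply smooth_density_mult; try exact Hc;
  apply smooth_density_kernel; apply H; exact Hq.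
- apply smooth_density_ccont. repeat apply smooth_density_mult; try exact Hc;
  try apply smooth_density_const; apply smooth_density_kernel; exact Hz.
- intros q Hq t Ht. destruct (H q Hq) as [_ K]. destruct (K t) as (N1 & N2 & B1 & B2).
  (* In the same notation, B^2 - A^2 - 2 (q - z) A^3 = (q - z)^2 A^2 B (B + 2 A); the last factor
     accounts for the constant 3 m. *)
  replace (c t * (/ (circ rho t - q) * / (circ rho t - q))
     - c t * (/ (circ rho t - z) * / (circ rho t - z))
     - (q - z) * (c t * (2 * (/ (circ rho t - z) * (/ (circ rho t - z) * / (circ rho t - z))))))%C
    with (c t * (a z t * (a z t * (a q t * (a q t + (a z t + a z t))))) * ((q - z) * (q - z)))%C
    by (unfold a; field; split; assumption).
  assert (B3 : Cmod (a q t + (a z t + a z t)) <= 3 * m).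
  { eapply Rle_trans; [apply Cmod_triangle|].
    assert (T := Cmod_triangle (a z t) (a z t)). lra. }
  rewrite !Cmod_mult. simpl pow. rewrite Rmult_1_r.
  apply Rmult_le_compat_r. { apply Rmult_le_pos; apply Cmod_ge_0. }
  repeat (apply Rmult_le_compat; try apply Cmod_ge_0;
    try (repeat apply Rmult_le_pos; apply Cmod_ge_0)); auto.
Qed.

End Kernels.

Lemma smooth_density_circ (rho : R) : smooth_density (circ rho).
Proof. intros p. eexists. apply rdiff_circ. Qed.

(* Cauchy's formula reads [f * N = G] with N and G kernel integrals. Both are twice differentiable,
   so f' = (G' - f N') / N is differentiable, and [N = 2 pi i] need only be known at 0. *)
Theorem derivative_cdiff (f df : C -> C) (r : R) : 0 < r ->
  (forall w, Cmod w < r -> cdiff f w (df w)) ->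
  exists r', 0 < r' <= r /\ forall w, Cmod w < r' -> exists l, cdiff df w l.
Proof.
intros Hr Hf. set (rho := r / 2). assert (Hrho : 0 < rho) by (unfold rho; lra).
set (c1 := fun t => (Ci * circ rho t)%C). set (c2 := fun t => (f (circ rho t) * c1 t)%C).
assert (S1 : smooth_density c1).
{ apply smooth_density_mult; [apply smooth_density_const | apply smooth_density_circ]. }
assert (S2 : smooth_density c2).
{ apply smooth_density_mult; [|exact S1]. intros p. eexists.
  rewrite <- (Cmult_0_r (df (circ rho (Im p)))).
  apply (rdiff_comp f); [apply rdiff_circ|]. apply Hf. rewrite Cmod_circ; unfold rho in *; lra. }
set (N := kernel1 rho c1). set (G := kernel1 rho c2).
assert (E : forall z, Cmod z < rho -> (f z * N z = G z)%C).
{ intros z Hz.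
  assert (T := cauchy_circle f rho z Hz
    ltac:(intros w Hw; exists (df w); apply Hf; unfold rho in *; lra)).
  assert (K := smooth_density_kernel rho z Hz).
  rewrite (CI_ext _ (fun t => c2 t * / (circ rho t - z) - f z * (c1 t * / (circ rho t - z)))%C) in T
    by (intros t; unfold c2, c1; ring).
  rewrite CI_minus in T.
  - rewrite CI_scal in T by (apply smooth_density_ccont, smooth_density_mult; assumption).
    unfold N, G, kernel1.
    match type of T with (?x - ?y)%C = _ => replace x with ((x - y) + y)%C by ring; rewrite T end.
    ring.
  - apply smooth_density_ccont, smooth_density_mult; assumption.
  - apply smooth_density_ccont. apply smooth_density_mult; [apply smooth_density_const|].
    apply smooth_density_mult; assumption. }
(* At the center the integrand i w / w is the constant i, so the integral is evaluated without any
   residue computation. *)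
assert (N0 : N 0 <> 0).
{ unfold N, kernel1. rewrite (CI_ext _ (fun _ => Ci)).
  - intros H. apply (f_equal snd) in H. unfold CI, Ci, Im in H. simpl in H.
    rewrite RInt_const in H. change ((2 * PI - 0) * 1 = 0) in H.
    assert (T := PI_RGT_0). lra.
  - intros t. assert (T := circ_sub_neq0 rho t 0). rewrite Cmod_0 in T. specialize (T Hrho).
    unfold c1. replace (circ rho t - 0)%C with (circ rho t) in * by ring. field. exact T. }
assert (DN : forall z, Cmod z < rho -> cdiff N z (kernel2 rho c1 z)).
{ intros z Hz. apply cdiff_kernel1; assumption. }
assert (DG : forall z, Cmod z < rho -> cdiff G z (kernel2 rho c2 z)).
{ intros z Hz. apply cdiff_kernel1; assumption. }
destruct (rdiff_lipschitz _ _ _ _ (DN 0 ltac:(rewrite Cmod_0; lra))) as (M & d & HM & Hd & L).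
apply Cmod_gt_0 in N0.
(* Closer to 0 than |N 0| / M, the Lipschitz bound keeps [N] from vanishing, which permits the
   division. *)
set (r' := Rmin rho (Rmin d (Cmod (N 0) / M))).
assert (R1 := Rmin_l rho (Rmin d (Cmod (N 0) / M))).
assert (R2 := Rmin_r rho (Rmin d (Cmod (N 0) / M))).
assert (R3 := Rmin_l d (Cmod (N 0) / M)). assert (R4 := Rmin_r d (Cmod (N 0) / M)).
fold r' in R1, R2.
assert (Hr' : 0 < r').
{ unfold r'. repeat apply Rmin_glb_lt; auto. apply Rdiv_lt_0_compat; lra. }
assert (NZ : forall z, Cmod z < r' -> N z <> 0).
{ intros z Hz H. specialize (L z). replace (z - 0)%C with z in L by ring.
  specialize (L ltac:(lra)). rewrite H in L.
  replace (0 - N 0)%C with (- N 0)%C in L by ring. rewrite Cmod_opp in L.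
  assert (M * Cmod z < M * (Cmod (N 0) / M)) by (apply Rmult_lt_compat_l; lra).
  replace (M * (Cmod (N 0) / M)) with (Cmod (N 0)) in H0 by (field; lra). lra. }
assert (ball : forall w, Cmod w < r' -> forall q, Cmod (q - w) < r' - Cmod w -> Cmod q < r').
{ intros w Hw q Hq. assert (T := Cmod_lower q w 0).
  replace (q - 0)%C with q in T by ring. replace (w - 0)%C with w in T by ring. lra. }
assert (F : forall z, Cmod z < r' ->
  ((kernel2 rho c2 z - f z * kernel2 rho c1 z) * / N z = df z)%C).
{ intros z Hz.
  assert (A := cdiff_mult _ _ _ _ _ (Hf z ltac:(unfold rho in *; lra)) (DN z ltac:(lra))).
  assert (B : cdiff (fun q => f q * N q)%C z (kernel2 rho c2 z)).
  { apply (cdiff_ext_loc G) with (r' - Cmod z); [lra | | apply DG; lra].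
    intros q Hq. symmetry. apply E. assert (T := ball z Hz q Hq). lra. }
  rewrite <- (cdiff_unique _ _ _ _ A B). field. apply NZ. exact Hz. }
exists r'. split; [unfold rho in *; lra|]. intros w Hw.
eexists. eapply (cdiff_ext_loc _ _ w _ (r' - Cmod w)); [lra | |].
- intros q Hq. apply F. apply ball with w; assumption.
- apply cdiff_mult.
  + apply cdiff_minus; [apply cdiff_kernel2; [exact S2 | lra]|].
    apply cdiff_mult; [apply Hf; unfold rho in *; lra|].
    apply cdiff_kernel2; [exact S1 | lra].
  + apply (cdiff_comp Cinv N); [apply DN; lra|]. apply cdiff_inv. apply NZ. exact Hw.
Qed.

(** * The function v *)

Lemma ln_neq0 (t : R) : 0 < t -> t <> 1 -> ln t <> 0.
Proof. intros H1 H2 E. apply H2. apply ln_inv; [lra|lra|]. rewrite ln_1. exact E. Qed.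

Lemma u_off_1 (t : R) : t <> 1 -> u t = (t - 1) / (t * ln t).
Proof. intros H. unfold u. destruct (Req_EM_T t 1); [contradiction|reflexivity]. Qed.

Lemma locally_pos_neq1 (t : R) : 0 < t -> t <> 1 -> locally t (fun x => 0 < x /\ x <> 1).
Proof.
intros H1 H2.
assert (Hd : 0 < Rmin t (Rabs (t - 1))).
{ apply Rmin_glb_lt; [lra|]. apply Rabs_pos_lt. lra. }
exists (mkposreal _ Hd). intros x Hx.
change (Rabs (x - t) < Rmin t (Rabs (t - 1))) in Hx.
assert (A := Rmin_l t (Rabs (t - 1))). assert (B := Rmin_r t (Rabs (t - 1))).
split.
- destruct (Rabs_def2 _ _ (Rlt_le_trans _ _ _ Hx A)). lra.
- intros ->. rewrite <- (Rabs_Ropp (1 - t)) in Hx. replace (- (1 - t)) with (t - 1) in Hx by ring. lra.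
Qed.

Lemma continuous_u (t : R) : 0 < t -> continuous u t.
Proof.
intros Ht. destruct (Req_EM_T t 1) as [->|N].
(* [s] is the difference quotient of ln at 1, continuous because ln' 1 = 1, and u t = 1 / (t s t);
   this removes the singularity of u. *)
- set (s := fun t => if Req_EM_T t 1 then 1 else ln t / (t - 1)).
  assert (Es : s 1 = 1). { unfold s. destruct (Req_EM_T 1 1); [reflexivity|lra]. }
  assert (Cs : continuous s 1).
  { apply filterlim_locally. intros eps.
    assert (He : 0 < eps / 2) by (assert (T := cond_pos eps); lra).
    assert (D1 : is_derive ln 1 1). { auto_derive; lra. }
    destruct (is_derive_eps _ _ _ D1 (eps / 2) He) as (d & Hd & D).
    exists (mkposreal d Hd). intros x Hx. change (Rabs (s x - s 1) < eps). rewrite Es.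
    unfold s. destruct (Req_EM_T x 1) as [Ex|Ex].
    - rewrite Rminus_diag, Rabs_R0. apply cond_pos.
    - assert (T := D x Hx). rewrite ln_1 in T.
      replace (ln x / (x - 1) - 1) with ((ln x - 0 - (x - 1) * 1) / (x - 1)) by (field; lra).
      assert (P : 0 < Rabs (x - 1)) by (apply Rabs_pos_lt; lra).
      rewrite Rabs_div by lra. apply Rle_lt_trans with (eps / 2); [|lra].
      apply Rmult_le_reg_r with (Rabs (x - 1)); [exact P|].
      unfold Rdiv at 1. rewrite Rmult_assoc, Rinv_l by lra. lra. }
  assert (Eu : forall x, 0 < x -> / (x * s x) = u x).
  { intros x Hx. unfold u, s. destruct (Req_EM_T x 1) as [->|N]; [field|].
    assert (T := ln_neq0 x Hx N). field. lra. }
  apply (continuous_ext_loc u (fun t => / (t * s t))).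
  + apply filter_imp with (fun x => 0 < x); [exact Eu | apply (open_gt 0 1); lra].
  + apply continuous_Rinv_comp; [|rewrite Es; lra].
    apply (continuous_mult (fun t : R => t) s); [apply continuous_id | exact Cs].
- apply (continuous_ext_loc u (fun t => (t - 1) / (t * ln t))).
  + apply filter_imp with (2 := locally_pos_neq1 t Ht N). intros x [_ Hx]. symmetry.
    apply u_off_1. exact Hx.
  + apply (ex_derive_continuous (V := R_NormedModule)). auto_derive.
    assert (T := ln_neq0 t Ht N). split; [exact Ht|]. split; [|trivial].
    apply Rmult_integral_contrapositive. lra.
Qed.

Definition vint (t : R) : R := t * (u t) ^ 2.

Lemma continuous_vint (t : R) : 0 < t -> continuous vint t.
Proof.
intros Ht. apply (continuous_mult (fun t : R => t) (fun t => (u t) ^ 2)).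
- apply continuous_id.
- apply (continuous_ext (fun t => u t * u t)); [intros; simpl; ring|].
  apply (continuous_mult u u); apply continuous_u; exact Ht.
Qed.

Lemma ex_RInt_vint (a b : R) : 0 < a -> 0 < b -> ex_RInt vint a b.
Proof.
intros Ha Hb. apply (ex_RInt_continuous (V := R_CompleteNormedModule)). intros x [Hx _].
apply continuous_vint. assert (0 < Rmin a b) by (apply Rmin_glb_lt; lra). lra.
Qed.

Lemma vint_Chasles (a b c : R) : 0 < a -> 0 < b -> 0 < c ->
  RInt vint a c = RInt vint a b + RInt vint b c.
Proof.
intros Ha Hb Hc. symmetry.
apply (RInt_Chasles (V := R_CompleteNormedModule)); apply ex_RInt_vint; assumption.
Qed.

Lemma vint_nonneg (t : R) : 0 < t -> 0 <= vint t.
Proof. intros Ht. unfold vint. apply Rmult_le_pos; [lra | apply pow2_ge_0]. Qed.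

Lemma RInt_vint_nonneg (a b : R) : 0 < a <= b -> 0 <= RInt vint a b.
Proof.
intros H. apply RInt_ge_0; [lra | apply ex_RInt_vint; lra |].
intros x Hx. apply vint_nonneg. lra.
Qed.

Lemma ln_neg (t : R) : 0 < t < 1 -> ln t < 0.
Proof. intros H. rewrite <- ln_1. apply ln_increasing; lra. Qed.

(* Near 0 the integrand is comparable to the derivative 1 / (t ln^2 t) of - 1 / ln t. *)
Lemma RInt_vint_bounds (x t : R) : 0 < x <= t -> t < 1 ->
  (1 - t) ^ 2 * (/ ln x - / ln t) <= RInt vint x t <= / ln x - / ln t.
Proof.
intros Hx Ht.
assert (I : is_RInt (fun s => / (s * ln s ^ 2)) x t (/ ln x - / ln t)).
{ replace (/ ln x - / ln t) with (minus (- / ln t) (- / ln x))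
    by (unfold minus, plus, opp; simpl; ring).
  apply (is_RInt_derive (fun s => - / ln s)); rewrite Rmin_left, Rmax_right by lra; intros s Hs;
  assert (N := ln_neg s ltac:(lra)).
  - auto_derive; [split; [lra|]; split; [lra | trivial] | simpl; field; lra].
  - apply (ex_derive_continuous (V := R_NormedModule)). auto_derive.
    split; [lra|]. split; [|trivial].
    apply Rmult_integral_contrapositive. split; [lra|].
    apply Rmult_integral_contrapositive. lra. }
assert (E : forall s, 0 < s <= t -> vint s = (1 - s) ^ 2 * / (s * ln s ^ 2)).
{ intros s Hs. assert (N := ln_neg s ltac:(lra)). unfold vint. rewrite u_off_1 by lra.
  field. lra. }
assert (P : forall s, 0 < s <= t -> 0 <= / (s * ln s ^ 2)).
{ intros s Hs. assert (N := ln_neg s ltac:(lra)). apply Rlt_le, Rinv_0_lt_compat.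
  apply Rmult_lt_0_compat; [lra|]. apply pow2_gt_0. lra. }
rewrite <- (is_RInt_unique _ _ _ _ I).
assert (X := ex_intro _ _ I : ex_RInt (fun s => / (s * ln s ^ 2)) x t).
split.
- assert (S := RInt_scal (V := R_CompleteNormedModule) _ _ _ ((1 - t) ^ 2) X).
  change ((1 - t) ^ 2 * RInt (fun s => / (s * ln s ^ 2)) x t)
    with (scal ((1 - t) ^ 2) (RInt (fun s => / (s * ln s ^ 2)) x t)).
  rewrite <- S. apply RInt_le; [lra | | apply ex_RInt_vint; lra |].
  + apply (ex_RInt_scal (V := R_NormedModule)). exact X.
  + intros s Hs. rewrite E by lra. change (scal ?a ?b) with (a * b).
    apply Rmult_le_compat_r; [apply P; lra|]. apply pow_incr. lra.
- apply RInt_le; [lra | apply ex_RInt_vint; lra | exact X |].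
  intros s Hs. rewrite E by lra. rewrite <- Rmult_1_l. apply Rmult_le_compat_r; [apply P; lra|].
  replace 1 with (1 ^ 2) at 2 by ring. apply pow_incr. lra.
Qed.

(** [L] is the improper integral over (0, 1/2]. Since the integrand is nonnegative it is obtained as
    a supremum, finite because the primitive - 1 / ln of the majorant tends to 0 at 0. The supremum
    is kept in the statement for the estimates of v that follow. *)
Lemma v_primitive : exists L,
  is_lub (fun y => exists x, 0 < x < / 2 /\ y = RInt vint x (/ 2)) L /\
  forall t, 0 < t -> v t = L + RInt vint (/ 2) t.
Proof.
destruct (completeness (fun y => exists x, 0 < x < / 2 /\ y = RInt vint x (/ 2))) as [L HL].
- exists (- / ln (/ 2)). intros y (x & Hx & ->).
  assert (B := RInt_vint_bounds x (/ 2) ltac:(lra) ltac:(lra)).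
  assert (T := Rinv_lt_0_compat _ (ln_neg x ltac:(lra))). lra.
- exists (RInt vint (/ 4) (/ 2)). exists (/ 4). split; [lra | reflexivity].
- exists L. split; [exact HL|]. intros t Ht.
  destruct HL as [U1 U2].
  apply is_RInt_gen_unique. intros Pr [eps HP].
  (* Any lower limit below [x0] will do: the integral up to 1/2 grows as its lower limit decreases,
     and never exceeds L. *)
  assert (exists x0, 0 < x0 < / 2 /\ L - eps < RInt vint x0 (/ 2)) as (x0 & Hx0 & B0).
  { apply NNPP. intros N. assert (L <= L - eps); [|assert (T := cond_pos eps); lra].
    apply U2. intros y (x & Hx & ->). apply Rnot_lt_le. intros H. apply N. exists x. auto. }
  exists (fun a => 0 < a < x0) (fun b => b = t).
  + exists (mkposreal x0 (proj1 Hx0)). intros y Hy Hy0.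
    change (Rabs (y - 0) < x0) in Hy. apply Rabs_def2 in Hy. lra.
  + reflexivity.
  + intros a b Ha ->. exists (RInt vint a t). simpl. split.
    * apply (RInt_correct (V := R_CompleteNormedModule)). apply ex_RInt_vint; lra.
    * apply HP. change (Rabs (RInt vint a t - (L + RInt vint (/ 2) t)) < eps).
      rewrite (vint_Chasles a (/ 2) t) by lra.
      assert (RInt vint a (/ 2) <= L). { apply U1. exists a. split; [lra | reflexivity]. }
      rewrite (vint_Chasles a x0 (/ 2)) in * by lra.
      assert (T := RInt_vint_nonneg a x0 ltac:(lra)).
      apply Rabs_def1; lra.
Qed.

Lemma is_derive_v (t : R) : 0 < t -> is_derive v t (t * (u t) ^ 2).
Proof.
intros Ht. destruct v_primitive as (L & _ & E).
apply (is_derive_ext_loc (fun t => L + RInt vint (/ 2) t)).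
- apply filter_imp with (fun x => 0 < x); [|apply (open_gt 0 t); lra].
  intros x Hx. symmetry. apply E. exact Hx.
- replace (t * u t ^ 2) with (plus 0 (vint t)) by (unfold plus, vint; simpl; ring).
  apply (is_derive_plus (V := R_NormedModule)); [exact (is_derive_const (V := R_NormedModule) L t)|].
  apply (is_derive_RInt _ _ (/ 2)); [|apply continuous_vint; exact Ht].
  apply filter_imp with (fun x => 0 < x); [|apply (open_gt 0 t); lra].
  intros x Hx. apply (RInt_correct (V := R_CompleteNormedModule)). apply ex_RInt_vint; lra.
Qed.

Lemma v_nonneg (t : R) : 0 < t -> 0 <= v t.
Proof.
intros Ht. destruct v_primitive as (L & [U1 _] & E). rewrite E by exact Ht.
destruct (Rlt_le_dec t (/ 2)) as [H|H].
- assert (RInt vint t (/ 2) <= L) by (apply U1; exists t; split; [lra | reflexivity]).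
  assert (C := vint_Chasles t (/ 2) t Ht ltac:(lra) Ht).
  rewrite (RInt_point (V := R_CompleteNormedModule)) in C. change zero with 0 in C. lra.
- assert (RInt vint (/ 4) (/ 2) <= L) by (apply U1; exists (/ 4); split; [lra | reflexivity]).
  assert (T1 := RInt_vint_nonneg (/ 4) (/ 2) ltac:(lra)).
  assert (T2 := RInt_vint_nonneg (/ 2) t ltac:(lra)). lra.
Qed.

(** The lower bound keeps only the integral over [t^2, t]: as ln (t^2) = 2 ln t, the primitive - 1 /
    ln changes there by half of - 1 / ln t. Losing a factor of about 2 is harmless, since v competes
    with a term of smaller order. *)
Lemma v_bounds (t : R) : 0 < t < / 2 ->
  (1 - t) ^ 2 / (2 * - ln t) <= v t <= / (- ln t).
Proof.
intros Ht. destruct v_primitive as (L & [U1 U2] & E). rewrite E by lra.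
assert (N := ln_neg t ltac:(lra)).
assert (C := vint_Chasles t (/ 2) t ltac:(lra) ltac:(lra) ltac:(lra)).
rewrite (RInt_point (V := R_CompleteNormedModule)) in C. change zero with 0 in C.
split.
- assert (t * t < t). { replace t with (t * 1) at 3 by ring. apply Rmult_lt_compat_l; lra. }
  assert (0 < t * t) by (apply Rmult_lt_0_compat; lra).
  assert (H1 : RInt vint (t * t) (/ 2) <= L) by (apply U1; exists (t * t); split; [lra | reflexivity]).
  rewrite (vint_Chasles _ t) in H1 by lra.
  destruct (RInt_vint_bounds (t * t) t ltac:(lra) ltac:(lra)) as [B _].
  rewrite ln_mult in B by lra.
  replace ((1 - t) ^ 2 * (/ (ln t + ln t) - / ln t)) with ((1 - t) ^ 2 / (2 * - ln t)) in B
    by (field; lra). lra.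
- assert (L <= / (- ln t) + RInt vint t (/ 2)); [|lra].
  assert (I : 0 < / (- ln t)) by (apply Rinv_0_lt_compat; lra).
  apply U2. intros y (x & Hx & ->).
  destruct (Rle_lt_dec x t) as [H|H].
  + rewrite (vint_Chasles x t (/ 2)) by lra.
    destruct (RInt_vint_bounds x t ltac:(lra) ltac:(lra)) as [_ B].
    assert (T := Rinv_lt_0_compat _ (ln_neg x ltac:(lra))).
    rewrite Rinv_opp. lra.
  + rewrite (vint_Chasles t x (/ 2)) by lra.
    assert (T := RInt_vint_nonneg t x ltac:(lra)). lra.
Qed.

(** * Second derivatives of ln g along the axes *)

(* [auto_derive] produces eta-expanded derivatives. *)
Ltac rewrite_derive H :=
  match type of H with is_derive ?f ?x ?l =>
    repeat change (Derive (fun t => f t) x) with (Derive f x);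
    rewrite ?(is_derive_unique f x l H)
  end.

Definition coef_a (t : R) : R := 1 + v t / t.
Definition coef_b (t : R) : R := (u t) ^ 2 - v t / t ^ 2.

(* For t <> 1, [sq0], [sq1], [sq2] are u^2 and its first two derivatives, and [coef_b1],
   [coef_b2] those of [coef_b]. *)
Definition sq0 (t : R) : R := ((t - 1) / (t * ln t)) ^ 2.
Definition sq1 (t : R) : R := 2 * (t - 1) * (ln t - t + 1) / (t ^ 3 * ln t ^ 3).
Definition sq2 (t : R) : R :=
  2 * ((ln t - t + 1) - (t - 1) ^ 2 / t) / (t ^ 3 * ln t ^ 3)
  - 6 * (t - 1) * (ln t - t + 1) * (ln t + 1) / (t ^ 4 * ln t ^ 4).
Definition coef_b1 (t : R) : R := sq1 t - sq0 t / t + 2 * v t / t ^ 3.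
Definition coef_b2 (t : R) : R := sq2 t - sq1 t / t + 3 * sq0 t / t ^ 2 - 6 * v t / t ^ 4.

Lemma grauert_coef (n : nat) (z X : nat -> C) :
  grauert n z X =
  coef_a (sqnorm n z) * sqnorm n X + coef_b (sqnorm n z) * Cmod (herm n X z) ^ 2.
Proof. reflexivity. Qed.

Lemma is_derive_coef_a (t : R) : 0 < t -> is_derive coef_a t (coef_b t).
Proof.
intros Ht. assert (D := is_derive_v t Ht). unfold coef_a, coef_b.
auto_derive.
- split; [eexists; exact D | split; [lra | trivial]].
- rewrite_derive D. field. lra.
Qed.

Lemma is_derive_coef_b (t : R) : 0 < t -> t <> 1 -> is_derive coef_b t (coef_b1 t).
Proof.
intros Ht N. assert (D := is_derive_v t Ht). assert (L := ln_neq0 t Ht N).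
apply (is_derive_ext_loc (fun t => sq0 t - v t / t ^ 2)).
- apply filter_imp with (2 := locally_pos_neq1 t Ht N). intros x [_ Hx].
  unfold coef_b, sq0. rewrite u_off_1 by exact Hx. reflexivity.
- unfold coef_b1, sq0, sq1. auto_derive.
  + repeat split; try (eexists; exact D); try lra; repeat apply Rmult_integral_contrapositive_currified; lra.
  + rewrite_derive D; rewrite u_off_1 by exact N. field. lra.
Qed.

Lemma is_derive_coef_b1 (t : R) : 0 < t -> t <> 1 -> is_derive coef_b1 t (coef_b2 t).
Proof.
intros Ht N. assert (D := is_derive_v t Ht). assert (L := ln_neq0 t Ht N).
unfold coef_b1, coef_b2, sq0, sq1, sq2. auto_derive.
- repeat split; try (eexists; exact D); try lra; repeat apply Rmult_integral_contrapositive_currified; lra.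
- rewrite_derive D; rewrite u_off_1 by exact N. field. lra.
Qed.

(* (ln H)'' for H = a(rho) N + b(rho) (W1^2 + W2^2), in terms of the derivatives of a, rho, N and
   the W's (a' = b). *)
Definition log_second (a b b1 b2 r1 r2 N N1 N2 W1 X1 X2 W2 Y1 Y2 : R) : R :=
  let M := W1 ^ 2 + W2 ^ 2 in
  let M1 := 2 * (W1 * X1 + W2 * Y1) in
  let M2 := 2 * (X1 ^ 2 + W1 * X2 + Y1 ^ 2 + W2 * Y2) in
  let H := a * N + b * M in
  let H1 := b * r1 * N + a * N1 + b1 * r1 * M + b * M1 in
  let H2 := b1 * r1 ^ 2 * N + b * r2 * N + 2 * b * r1 * N1 + a * N2
            + b2 * r1 ^ 2 * M + b1 * r2 * M + 2 * b1 * r1 * M1 + b * M2 in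
  H2 / H - (H1 / H) ^ 2.

(** First derivatives are assumed on a neighbourhood, because the inner [Derive] must become a
    formula near 0 before the outer one is taken; second derivatives are needed at the point only.
    As [B] is also the derivative of [A], [B1] serves as A''. *)
Lemma Derive2_ln_metric (A B B1 : R -> R) (b2 : R) (rh N W1 W2 rh1 N1 X1 Y1 : R -> R)
    (rh2 N2 X2 Y2 : R) :
  locally (rh 0) (fun t => is_derive A t (B t) /\ is_derive B t (B1 t)) ->
  is_derive B1 (rh 0) b2 ->
  locally 0 (fun s => is_derive rh s (rh1 s) /\ is_derive N s (N1 s) /\
                      is_derive W1 s (X1 s) /\ is_derive W2 s (Y1 s)) ->
  is_derive rh1 0 rh2 -> is_derive N1 0 N2 -> is_derive X1 0 X2 -> is_derive Y1 0 Y2 ->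
  0 < A (rh 0) * N 0 + B (rh 0) * (W1 0 ^ 2 + W2 0 ^ 2) ->
  Derive (fun s => Derive (fun s' =>
     ln (A (rh s') * N s' + B (rh s') * (W1 s' ^ 2 + W2 s' ^ 2))) s) 0
  = log_second (A (rh 0)) (B (rh 0)) (B1 (rh 0)) b2 (rh1 0) rh2 (N 0) (N1 0) N2
      (W1 0) (X1 0) X2 (W2 0) (Y1 0) Y2.
Proof.
intros LA DB1 L0 Drh1 DN1 DX1 DY1 Hpos.
set (H := fun s => A (rh s) * N s + B (rh s) * (W1 s ^ 2 + W2 s ^ 2)).
set (H1 := fun s => B (rh s) * rh1 s * N s + A (rh s) * N1 s
   + B1 (rh s) * rh1 s * (W1 s ^ 2 + W2 s ^ 2) + B (rh s) * (2 * (W1 s * X1 s + W2 s * Y1 s))).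
destruct (locally_singleton _ _ L0) as (Drh & DN & DW1 & DW2).
destruct (locally_singleton _ _ LA) as (DA & DB).
assert (Crh : continuous rh 0) by (apply (ex_derive_continuous (V := R_NormedModule)); eexists; exact Drh).
assert (DH : locally 0 (fun s => is_derive H s (H1 s))).
{ assert (LA' := Crh _ LA). unfold filtermap in LA'.
  generalize (filter_and _ _ LA' L0). apply filter_imp.
  intros s ((a1 & a2) & d1 & d2 & d3 & d4). unfold H, H1. auto_derive.
  - repeat split; eexists; eassumption.
  - rewrite_derive a1; rewrite_derive a2; rewrite_derive d1; rewrite_derive d2; rewrite_derive d3; rewrite_derive d4. ring. }
assert (DH0 := locally_singleton _ _ DH).
assert (CH : continuous H 0) by (apply (ex_derive_continuous (V := R_NormedModule)); eexists; exact DH0).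
assert (PH : locally 0 (fun s => 0 < H s)) by exact (CH _ (open_gt 0 (H 0) Hpos)).
rewrite (Derive_ext_loc _ (fun s => H1 s / H s)).
- apply is_derive_unique.
  replace (log_second _ _ _ _ _ _ _ _ _ _ _ _ _ _ _) with
    (((B1 (rh 0) * rh1 0 ^ 2 * N 0 + B (rh 0) * rh2 * N 0 + 2 * B (rh 0) * rh1 0 * N1 0
      + A (rh 0) * N2 + b2 * rh1 0 ^ 2 * (W1 0 ^ 2 + W2 0 ^ 2) + B1 (rh 0) * rh2 * (W1 0 ^ 2 + W2 0 ^ 2)
      + 2 * B1 (rh 0) * rh1 0 * (2 * (W1 0 * X1 0 + W2 0 * Y1 0))
      + B (rh 0) * (2 * (X1 0 ^ 2 + W1 0 * X2 + Y1 0 ^ 2 + W2 0 * Y2))) * H 0 - H1 0 * H1 0) / H 0 ^ 2).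
  2:{ unfold log_second. fold (H 0). fold (H1 0). cbv zeta.
      change (A (rh 0) * N 0 + B (rh 0) * (W1 0 ^ 2 + W2 0 ^ 2)) with (H 0).
      change (B (rh 0) * rh1 0 * N 0 + A (rh 0) * N1 0 + B1 (rh 0) * rh1 0 * (W1 0 ^ 2 + W2 0 ^ 2) +
          B (rh 0) * (2 * (W1 0 * X1 0 + W2 0 * Y1 0))) with (H1 0).
      field. unfold H. lra. }
  apply (is_derive_div H1 H); [| exact DH0 | unfold H; lra].
  unfold H1. auto_derive.
  + repeat split; eexists; eassumption.
  + rewrite_derive DA; rewrite_derive DB; rewrite_derive DB1; rewrite_derive Drh; rewrite_derive DN; rewrite_derive DW1; rewrite_derive DW2; rewrite_derive Drh1; rewrite_derive DN1; rewrite_derive DX1; rewrite_derive DY1. ring.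
- generalize (filter_and _ _ DH PH). apply filter_imp. intros s [d p].
  apply is_derive_unique. change (is_derive (fun s' => ln (H s')) s (H1 s / H s)).
  auto_derive; [split; [eexists; exact d | split; [exact p | trivial]]|].
  rewrite_derive d. field. lra.
Qed.

(** * Curves in C, Hermitian products, and the metric along a disk *)

Definition curve_der (F : R -> C) (s : R) (l : C) : Prop :=
  is_derive (fun s => Re (F s)) s (Re l) /\ is_derive (fun s => Im (F s)) s (Im l).

Lemma curve_der_mult (F G : R -> C) (s : R) (l m : C) :
  curve_der F s l -> curve_der G s m ->
  curve_der (fun s => F s * G s)%C s (l * G s + F s * m)%C.
Proof.
intros [F1 F2] [G1 G2].
assert (M1 := is_derive_mult _ _ _ _ _ F1 G1 Rmult_comm).
assert (M2 := is_derive_mult _ _ _ _ _ F2 G2 Rmult_comm).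
assert (M3 := is_derive_mult _ _ _ _ _ F1 G2 Rmult_comm).
assert (M4 := is_derive_mult _ _ _ _ _ F2 G1 Rmult_comm).
split.
- replace (Re (l * G s + F s * m)) with
    (Re l * Re (G s) + Re (F s) * Re m - (Im l * Im (G s) + Im (F s) * Im m))
    by (unfold Re, Im; simpl; ring).
  exact (is_derive_minus (V := R_NormedModule) _ _ _ _ _ M1 M2).
- replace (Im (l * G s + F s * m)) with
    (Re l * Im (G s) + Re (F s) * Im m + (Im l * Re (G s) + Im (F s) * Re m))
    by (unfold Re, Im; simpl; ring).
  exact (is_derive_plus (V := R_NormedModule) _ _ _ _ _ M3 M4).
Qed.

Lemma curve_der_plus (F G : R -> C) (s : R) (l m : C) :
  curve_der F s l -> curve_der G s m -> curve_der (fun s => F s + G s)%C s (l + m)%C.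
Proof.
intros [F1 F2] [G1 G2]. split.
- exact (is_derive_plus (V := R_NormedModule) _ _ _ _ _ F1 G1).
- exact (is_derive_plus (V := R_NormedModule) _ _ _ _ _ F2 G2).
Qed.

Lemma curve_der_const (c : C) (s : R) : curve_der (fun _ => c) s 0.
Proof. split; exact (is_derive_const (V := R_NormedModule) _ s). Qed.

Lemma curve_der_conj (F : R -> C) (s : R) (l : C) :
  curve_der F s l -> curve_der (fun s => Cconj (F s)) s (Cconj l).
Proof.
intros [F1 F2]. split; [exact F1|]. exact (is_derive_opp (V := R_NormedModule) _ _ _ F2).
Qed.

Lemma curve_der_eq (F : R -> C) (s : R) (l m : C) : curve_der F s l -> l = m -> curve_der F s m.
Proof. intros H <-. exact H. Qed.

Lemma curve_der_herm (n : nat) (X Z : R -> nat -> C) (dX dZ : nat -> C) (s : R) :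
  (forall j, (j < n)%nat -> curve_der (fun s => X s j) s (dX j)) ->
  (forall j, (j < n)%nat -> curve_der (fun s => Z s j) s (dZ j)) ->
  curve_der (fun s => herm n (X s) (Z s)) s (herm n dX (Z s) + herm n (X s) dZ)%C.
Proof.
intros HX HZ. induction n as [|n IH].
- change (curve_der (fun _ => RtoC 0) s (0 + 0)%C).
  rewrite Cplus_0_l. apply curve_der_const.
- eapply curve_der_eq.
  + apply (curve_der_plus (fun s => herm n (X s) (Z s)) (fun s => X s n * Cconj (Z s n))%C).
    * exact (IH (fun j Hj => HX j (Nat.lt_lt_succ_r _ _ Hj)) (fun j Hj => HZ j (Nat.lt_lt_succ_r _ _ Hj))).
    * apply curve_der_mult; [apply HX; lia|]. apply curve_der_conj. apply HZ. lia.
  + unfold herm; simpl. ring.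
Qed.

Lemma herm_scal_l (n : nat) (e : C) (X Z : nat -> C) :
  herm n (fun j => e * X j)%C Z = (e * herm n X Z)%C.
Proof.
unfold herm. induction n as [|n IH]; simpl; [ring|]. rewrite IH. ring.
Qed.

Lemma herm_scal_r (n : nat) (e : C) (X Z : nat -> C) :
  herm n X (fun j => e * Z j)%C = (Cconj e * herm n X Z)%C.
Proof.
unfold herm. induction n as [|n IH]; simpl; [ring|]. rewrite IH, Cmult_conj. ring.
Qed.

Lemma herm_conj (n : nat) (X Z : nat -> C) : herm n Z X = Cconj (herm n X Z).
Proof.
unfold herm. induction n as [|n IH]; simpl.
- unfold Cconj, RtoC; simpl. f_equal. ring.
- rewrite IH, Cplus_conj, Cmult_conj, Cconj_conj. ring.
Qed.

Lemma herm_ext (n : nat) (X X' Z Z' : nat -> C) :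
  (forall j, (j < n)%nat -> X j = X' j) -> (forall j, (j < n)%nat -> Z j = Z' j) ->
  herm n X Z = herm n X' Z'.
Proof.
intros HX HZ. unfold herm. induction n as [|n IH]; simpl; [reflexivity|].
rewrite IH by auto. rewrite HX, HZ by lia. reflexivity.
Qed.

Lemma herm_self (n : nat) (X : nat -> C) : herm n X X = RtoC (sqnorm n X).
Proof.
unfold herm, sqnorm. induction n as [|n IH]; cbn [sumR sumC]; [reflexivity|].
rewrite IH, RtoC_plus. f_equal. rewrite <- Cmod2_conj. reflexivity.
Qed.

Lemma sqnorm_herm (n : nat) (X : nat -> C) : sqnorm n X = Re (herm n X X).
Proof. rewrite herm_self. reflexivity. Qed.

Lemma sqnorm_ext (n : nat) (X Z : nat -> C) :
  (forall j, (j < n)%nat -> X j = Z j) -> sqnorm n X = sqnorm n Z.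
Proof. intros H. rewrite !sqnorm_herm. f_equal. apply herm_ext; exact H. Qed.

Lemma sqnorm_nonneg (n : nat) (X : nat -> C) : 0 <= sqnorm n X.
Proof.
unfold sqnorm. induction n as [|n IH]; cbn [sumR]; [lra|].
apply Rplus_le_le_0_compat; [exact IH | apply pow2_ge_0].
Qed.

Lemma curve_der_sqnorm (n : nat) (X : R -> nat -> C) (dX : nat -> C) (s : R) :
  (forall j, (j < n)%nat -> curve_der (fun s => X s j) s (dX j)) ->
  is_derive (fun s => sqnorm n (X s)) s (2 * Re (herm n dX (X s))).
Proof.
intros H. destruct (curve_der_herm n X X dX dX s H H) as [K _].
apply (is_derive_ext (fun s => Re (herm n (X s) (X s)))).
- intros t. symmetry. apply sqnorm_herm.
- rewrite (herm_conj n dX (X s)) in K.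
  replace (2 * Re (herm n dX (X s))) with (Re (herm n dX (X s) + Cconj (herm n dX (X s)))).
  + exact K.
  + unfold Re, Cconj; simpl. ring.
Qed.

(** A general unit direction [e] treats at once the two axes, [1] and [Ci], over which the Laplacian
    in the curvature is summed. *)
Lemma cdiff_curve (f : C -> C) (e l : C) (s : R) : Cmod e = 1 ->
  cdiff f (s * e)%C l -> curve_der (fun s => f (s * e)%C) s (e * l)%C.
Proof.
intros He H. rewrite cdiffE in H.
assert (K : forall eps : posreal, exists d : posreal, forall y, Rabs (y - s) < d ->
  Cmod (f (y * e) - f (s * e) - RtoC (y - s) * (e * l))%C <= eps * Rabs (y - s)).
{ intros eps. destruct (H eps (cond_pos eps)) as (d & Hd & D).
  exists (mkposreal d Hd). intros y Hy. specialize (D (y * e)%C).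
  replace (y * e - s * e)%C with (RtoC (y - s) * e)%C in D by (rewrite RtoC_minus; ring).
  rewrite Cmod_mult, Cmod_R, He, Rmult_1_r in D.
  rewrite <- Cmult_assoc in D. apply D. exact Hy. }
split; (split; [apply is_linear_scal_l|]); intros x Hx;
apply (is_filter_lim_locally_unique (K := R_AbsRing) (V := R_NormedModule)) in Hx; rewrite <- Hx; intros eps; destruct (K eps) as [d D];
exists d; intros y Hy; specialize (D y Hy);
(eapply Rle_trans; [|exact D]).
- eapply Rle_trans; [|apply (proj1 (re_im_bound _))]. right.
  change (Rabs (Re (f (y * e)%C) - Re (f (s * e)%C) - (y - s) * Re (e * l)) =
   Rabs (Re (f (y * e) - f (s * e) - (y - s)%R * (e * l))%C)).
  f_equal. unfold Re; simpl. ring.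
- eapply Rle_trans; [|apply (proj2 (re_im_bound _))]. right.
  change (Rabs (Im (f (y * e)%C) - Im (f (s * e)%C) - (y - s) * Im (e * l)) =
   Rabs (Im (f (y * e) - f (s * e) - (y - s)%R * (e * l))%C)).
  f_equal. unfold Im; simpl. ring.
Qed.

Lemma curve_der_scal (c : C) (F : R -> C) (s : R) (l : C) :
  curve_der F s l -> curve_der (fun s => c * F s)%C s (c * l)%C.
Proof.
intros H. eapply curve_der_eq; [apply curve_der_mult; [apply curve_der_const | exact H]|]. cbv beta. ring.
Qed.

Lemma curve_der_RtoC (f : R -> R) (s l : R) :
  is_derive f s l -> curve_der (fun s => RtoC (f s)) s (RtoC l).
Proof. intros H. split; [exact H | exact (is_derive_const (V := R_NormedModule) 0 s)]. Qed.

Lemma is_derive_2Re (F : R -> C) (s : R) (l : C) :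
  curve_der F s l -> is_derive (fun s => 2 * Re (F s)) s (2 * Re l).
Proof. intros [H _]. exact (is_derive_scal _ _ 2 _ H). Qed.

(* Second derivative of ln g(phi, phi') along T = s e at s = 0, where z, X, B, D are the values
   at 0 of phi and its first three derivatives. *)
Definition axis_log_second (n : nat) (e : C) (z X B D : nat -> C) : R :=
  let r := sqnorm n z in
  let W1 := (e * herm n B z + Cconj e * sqnorm n X)%C in
  let W2 := (e * (e * herm n D z + Cconj e * herm n B X)
             + Cconj e * RtoC (2 * Re (e * herm n B X)))%C in
  log_second (coef_a r) (coef_b r) (coef_b1 r) (coef_b2 r)
    (2 * Re (e * herm n X z)) (2 * Re (e * W1))
    (sqnorm n X) (2 * Re (e * herm n B X))
    (2 * Re (e * (e * herm n D X + Cconj e * sqnorm n B)))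
    (Re (herm n X z)) (Re W1) (Re W2) (Im (herm n X z)) (Im W1) (Im W2).

Section Jets.

Variables (n : nat) (phi dphi d2 d3 : C -> nat -> C) (r0 : R).
Hypothesis Hr0 : 0 < r0.
Hypothesis Hphi : forall T, Cmod T < r0 -> forall j, (j < n)%nat ->
  cdiff (fun w => phi w j) T (dphi T j) /\ cdiff (fun w => dphi w j) T (d2 T j) /\
  cdiff (fun w => d2 w j) T (d3 T j).

Let z := phi 0.
Let X := dphi 0.

Hypothesis Hz : 0 < sqnorm n z.
Hypothesis Hz1 : sqnorm n z <> 1.
Hypothesis HX : 0 < grauert n z X.

Lemma Derive2_ln_grauert (e : C) : Cmod e = 1 ->
  Derive (fun s => Derive (fun s' =>
    ln (grauert n (phi (RtoC s' * e)%C) (dphi (RtoC s' * e)%C))) s) 0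
  = axis_log_second n e z X (d2 0) (d3 0).
Proof.
intros He.
assert (Hc : forall s, Rabs s < r0 -> forall j, (j < n)%nat ->
  curve_der (fun s => phi (RtoC s * e)%C j) s (e * dphi (RtoC s * e)%C j)%C /\
  curve_der (fun s => dphi (RtoC s * e)%C j) s (e * d2 (RtoC s * e)%C j)%C /\
  curve_der (fun s => d2 (RtoC s * e)%C j) s (e * d3 (RtoC s * e)%C j)%C).
{ intros s Hs j Hj.
  destruct (Hphi (RtoC s * e)%C ltac:(rewrite Cmod_mult, Cmod_R, He; lra) j Hj) as (A1 & A2 & A3).
  split; [exact (cdiff_curve _ e _ s He A1)|]. split; [exact (cdiff_curve _ e _ s He A2)|].
  exact (cdiff_curve _ e _ s He A3). }
set (p := fun s : R => phi (RtoC s * e)%C) in *.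
set (dp := fun s : R => dphi (RtoC s * e)%C) in *.
set (p2 := fun s : R => d2 (RtoC s * e)%C) in *.
set (p3 := fun s : R => d3 (RtoC s * e)%C) in *.
assert (E0 : (RtoC 0 * e)%C = RtoC 0) by ring.
assert (Drh : forall s, Rabs s < r0 ->
  is_derive (fun s => sqnorm n (p s)) s (2 * Re (e * herm n (dp s) (p s)))).
{ intros s Hs. rewrite <- herm_scal_l.
  apply (curve_der_sqnorm n p). intros j Hj. apply (Hc s Hs j Hj). }
assert (DN : forall s, Rabs s < r0 ->
  is_derive (fun s => sqnorm n (dp s)) s (2 * Re (e * herm n (p2 s) (dp s)))).
{ intros s Hs. rewrite <- herm_scal_l.
  apply (curve_der_sqnorm n dp). intros j Hj. apply (Hc s Hs j Hj). }
assert (DH : forall (F dF G dG : R -> nat -> C) s,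
  (forall j, (j < n)%nat -> curve_der (fun s => F s j) s (e * dF s j)%C) ->
  (forall j, (j < n)%nat -> curve_der (fun s => G s j) s (e * dG s j)%C) ->
  curve_der (fun s => herm n (F s) (G s)) s
    (e * herm n (dF s) (G s) + Cconj e * herm n (F s) (dG s))%C).
{ intros F dF G dG s HF HG. eapply curve_der_eq; [exact (curve_der_herm n F G _ _ s HF HG)|].
  rewrite herm_scal_l, herm_scal_r. reflexivity. }
assert (DW : forall s, Rabs s < r0 -> curve_der (fun s => herm n (dp s) (p s)) s
    (e * herm n (p2 s) (p s) + Cconj e * sqnorm n (dp s))%C).
{ intros s Hs. rewrite <- herm_self. apply (DH dp p2 p dp); intros j Hj; apply (Hc s Hs j Hj). }
assert (R00 : Rabs 0 < r0) by (rewrite Rabs_R0; exact Hr0).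
assert (DY : curve_der (fun s => herm n (p2 s) (p s)) 0
    (e * herm n (p3 0) (p 0) + Cconj e * herm n (p2 0) (dp 0))%C).
{ apply (DH p2 p3 p dp); intros j Hj; apply (Hc 0 R00 j Hj). }
assert (DY' : curve_der (fun s => herm n (p2 s) (dp s)) 0
    (e * herm n (p3 0) (dp 0) + Cconj e * sqnorm n (p2 0))%C).
{ rewrite <- herm_self. apply (DH p2 p3 dp p2); intros j Hj; apply (Hc 0 R00 j Hj). }
assert (DW1 : curve_der (fun s => e * herm n (p2 s) (p s) + Cconj e * sqnorm n (dp s))%C 0
   (e * (e * herm n (p3 0) (p 0) + Cconj e * herm n (p2 0) (dp 0))
    + Cconj e * RtoC (2 * Re (e * herm n (p2 0) (dp 0))))%C).
{ apply curve_der_plus; apply curve_der_scal; [exact DY|].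
  apply curve_der_RtoC. exact (DN 0 R00). }
assert (Pz : p 0 = z) by (unfold p, z; rewrite E0; reflexivity).
assert (PX : dp 0 = X) by (unfold dp, X; rewrite E0; reflexivity).
assert (P2 : p2 0 = d2 0) by (unfold p2; rewrite E0; reflexivity).
assert (P3 : p3 0 = d3 0) by (unfold p3; rewrite E0; reflexivity).
rewrite (Derive_ext _ (fun s => Derive (fun s' =>
  ln (coef_a (sqnorm n (p s')) * sqnorm n (dp s') + coef_b (sqnorm n (p s'))
   * (Re (herm n (dp s') (p s')) ^ 2 + Im (herm n (dp s') (p s')) ^ 2))) s)).
2:{ intros s. apply Derive_ext. intros t. rewrite grauert_coef.
    apply (f_equal ln). f_equal. f_equal. rewrite <- Cmod2_alt. reflexivity. }
rewrite (Derive2_ln_metric coef_a coef_b coef_b1 (coef_b2 (sqnorm n z)) (fun s => sqnorm n (p s))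
  (fun s => sqnorm n (dp s)) (fun s => Re (herm n (dp s) (p s))) (fun s => Im (herm n (dp s) (p s)))
  (fun s => 2 * Re (e * herm n (dp s) (p s))) (fun s => 2 * Re (e * herm n (p2 s) (dp s)))
  (fun s => Re (e * herm n (p2 s) (p s) + Cconj e * sqnorm n (dp s))%C)
  (fun s => Im (e * herm n (p2 s) (p s) + Cconj e * sqnorm n (dp s))%C)
  (2 * Re (e * (e * herm n (p2 0%R) (p 0%R) + Cconj e * sqnorm n (dp 0%R)))%C)
  (2 * Re (e * (e * herm n (p3 0%R) (dp 0%R) + Cconj e * sqnorm n (p2 0%R)))%C)
  _ _) with (6 := proj1 DW1) (7 := proj2 DW1).
- unfold axis_log_second. rewrite Pz, PX, P2, P3. reflexivity.
- rewrite Pz. apply filter_imp with (2 := locally_pos_neq1 _ Hz Hz1). intros t [T1 T2].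
  split; [apply is_derive_coef_a | apply is_derive_coef_b]; assumption.
- rewrite Pz. apply is_derive_coef_b1; assumption.
- exists (mkposreal r0 Hr0). intros s Hs. change (Rabs (s - 0) < r0) in Hs.
  rewrite Rminus_0_r in Hs. split; [exact (Drh s Hs)|]. split; [exact (DN s Hs)|]. exact (DW s Hs).
- apply is_derive_2Re. apply curve_der_scal. exact (DW 0 R00).
- apply is_derive_2Re. apply curve_der_scal. exact DY'.
- rewrite Pz, PX. rewrite grauert_coef in HX.
  replace (Re (herm n X z) ^ 2 + Im (herm n X z) ^ 2) with (Cmod (herm n X z) ^ 2); [exact HX|].
  rewrite <- Cmod2_alt. reflexivity.
Qed.

Lemma gauss_curv_jet :
  gauss_curv_at0 (fun T => grauert n (phi T) (dphi T)) =
  - 2 / grauert n z X * / 4 *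
  (axis_log_second n 1 z X (d2 0) (d3 0) + axis_log_second n Ci z X (d2 0) (d3 0)).
Proof.
unfold gauss_curv_at0. change (0, 0) with (RtoC 0). fold z X.
rewrite <- (Derive2_ln_grauert 1 Cmod_1), <- (Derive2_ln_grauert Ci Cmod_Ci).
f_equal. f_equal; apply Derive_ext; intros s; apply Derive_ext; intros t.
- replace (RtoC t * 1)%C with ((t, 0) : C) by (rewrite Cmult_1_r; reflexivity). reflexivity.
- replace (RtoC t * Ci)%C with ((0, t) : C); [reflexivity|].
  unfold Cmult, RtoC, Ci; simpl. f_equal; ring.
Qed.

End Jets.

(** * Directions orthogonal to z *)

Lemma Rbar_lub_correct (E : Rbar -> Prop) : Rbar_is_lub E (Rbar_lub E).
Proof. exact (proj2_sig (Rbar_ex_lub E)). Qed.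

Lemma Rbar_glb_correct (E : Rbar -> Prop) : Rbar_is_glb E (Rbar_glb E).
Proof. exact (proj2_sig (Rbar_ex_glb E)). Qed.

Lemma cdiff_const (c p : C) : cdiff (fun _ => c) p 0.
Proof. unfold cdiff. rewrite Cmult_0_r. apply rdiff_const. Qed.

Lemma is_derive_cdiff (f : C -> C) (p l : C) :
  cdiff f p l -> is_derive (K := C_AbsRing) (V := C_NormedModule) f p l.
Proof.
intros H. rewrite cdiffE in H. split; [apply is_linear_scal_l|]. intros x Hx.
apply (is_filter_lim_locally_unique (K := C_AbsRing) (V := AbsRing_NormedModule C_AbsRing)) in Hx.
rewrite <- Hx. intros eps. destruct (H eps (cond_pos eps)) as (d & Hd & D).
exists (mkposreal d Hd). intros y Hy. exact (D y Hy).
Qed.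

(** On the linear disk the first derivative of the metric vanishes at 0. Its second derivative 4 b
    |X|^4 comes in equal halves from the growth of |phi|^2 inside a, and from <phi', phi> leaving 0
    in the second term of the metric. *)
Lemma axis_log_second_orthogonal (n : nat) (e : C) (z X : nat -> C) :
  Cmod e = 1 -> herm n X z = 0 -> sqnorm n X <> 0 -> coef_a (sqnorm n z) <> 0 ->
  axis_log_second n e z X (fun _ => 0) (fun _ => 0)
  = 4 * coef_b (sqnorm n z) * sqnorm n X / coef_a (sqnorm n z).
Proof.
intros He H HX Ha. unfold axis_log_second.
assert (H0 : forall Z, herm n (fun _ => 0) Z = 0).
{ intros Z. transitivity (herm n (fun j => 0 * Z j)%C Z).
  - apply herm_ext; intros; [ring | reflexivity].
  - rewrite herm_scal_l. ring. }
assert (S0 : sqnorm n (fun _ => RtoC 0) = 0) by (rewrite sqnorm_herm, H0; reflexivity).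
rewrite H, !H0, S0.
assert (E : fst e ^ 2 + snd e ^ 2 = 1).
{ change (Re e ^ 2 + Im e ^ 2 = 1). rewrite <- Cmod2_alt, He. ring. }
generalize (coef_b1 (sqnorm n z)) (coef_b2 (sqnorm n z)) (coef_b (sqnorm n z)) (sqnorm n X) HX (coef_a (sqnorm n z)) Ha.
intros b1 b2 b m Hm a Ha'.
destruct e as [e1 e2]. cbn [fst snd] in E. unfold log_second, Re, Im, Cmult, Cplus, Cconj, RtoC. simpl.
replace (4 * b * m / a) with (4 * b * m * (e1 ^ 2 + e2 ^ 2) / a) by (rewrite E; field; exact Ha').
field. split; assumption.
Qed.

Lemma linear_disk_curvature (n : nat) (z X : nat -> C) :
  0 < sqnorm n z -> sqnorm n z <> 1 -> sqnorm n X <> 0 -> herm n X z = 0 ->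
  0 < coef_a (sqnorm n z) ->
  Rbar_le (Finite (- 4 * coef_b (sqnorm n z) / coef_a (sqnorm n z) ^ 2)) (hsc n z X).
Proof.
intros Hz Hz1 HX Horth Ha.
set (phi := fun (T : C) (j : nat) => (z j + T * X j)%C).
set (dphi := fun (_ : C) (j : nat) => X j).
assert (P0 : forall j, phi (RtoC 0) j = z j) by (intros j; unfold phi; ring).
assert (Er : sqnorm n (phi 0) = sqnorm n z) by (apply sqnorm_ext; intros; apply P0).
assert (Eh : herm n X (phi 0) = 0).
{ transitivity (herm n X z); [|exact Horth]. apply herm_ext; intros; [reflexivity | apply P0]. }
assert (Eg : grauert n (phi 0) X = coef_a (sqnorm n z) * sqnorm n X).
{ rewrite grauert_coef, Eh, Er, Cmod_0. ring. }
assert (PX : 0 < sqnorm n X) by (assert (T := sqnorm_nonneg n X); lra).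
assert (Hlin : forall T j, is_derive (K := C_AbsRing) (V := C_NormedModule) (fun T' => phi T' j) T (X j)).
{ intros T j. apply is_derive_cdiff. apply cdiff_square_bound with 0 1; [lra|]. intros q _.
  unfold phi. replace (z j + q * X j - (z j + T * X j) - (q - T) * X j)%C with (RtoC 0) by ring.
  rewrite Cmod_0. lra. }
(* By Pythagoras |z + T X|^2 >= |z|^2, so the disk avoids the origin for every T and the radius 1 is
   arbitrary. *)
assert (Hex : exists r, 0 < r /\ forall T, Cmod T < r -> sqnorm n (phi T) <> 0).
{ assert (NE : forall T, sqnorm n (phi T) = sqnorm n z + Cmod T ^ 2 * sqnorm n X).
  { intros T. apply RtoC_inj. rewrite <- herm_self.
    rewrite RtoC_plus, RtoC_mult, Cmod2_conj.
    rewrite <- (herm_self n z), <- (herm_self n X).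
    assert (Horth' : herm n z X = 0).
    { rewrite (herm_conj n X z), Horth. unfold Cconj, RtoC; simpl. f_equal. ring. }
    transitivity (herm n z z + T * herm n X z + Cconj T * herm n z X
       + T * Cconj T * herm n X X)%C; [|rewrite Horth, Horth'; ring].
    unfold herm, phi. clear. induction n as [|m IH]; simpl; [ring|].
    rewrite IH, Cplus_conj, Cmult_conj. ring. }
  exists 1. split; [lra|]. intros T _. rewrite NE.
  assert (T1 := pow2_ge_0 (Cmod T)).
  assert (0 <= Cmod T ^ 2 * sqnorm n X) by (apply Rmult_le_pos; lra). lra. }
destruct Hex as (r & Hr & Hnz).
assert (J := gauss_curv_jet n phi dphi (fun _ _ => RtoC 0) (fun _ _ => RtoC 0) r Hr).
rewrite Er in J. change (dphi 0) with X in J. rewrite Eg in J.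
specialize (J ltac:(intros T _ j _; split;
  [apply cdiff_is_derive, Hlin | split; [exact (cdiff_const (X j) T) | exact (cdiff_const 0 T)]]) Hz Hz1
  ltac:(apply Rmult_lt_0_compat; assumption)).
rewrite !axis_log_second_orthogonal in J
  by (rewrite ?Er; auto using Cmod_1, Cmod_Ci; lra).
rewrite Er in J.
replace (- 4 * coef_b (sqnorm n z) / coef_a (sqnorm n z) ^ 2) with
  (gauss_curv_at0 (fun T => grauert n (phi T) (dphi T))) by (rewrite J; field; lra).
apply (proj1 (Rbar_lub_correct _)). exists phi, dphi. split; [|reflexivity].
split.
- exists r. split; [exact Hr|]. intros T HT. split; [apply Hnz; exact HT|]. intros j _. apply Hlin.
- intros j _. split; [apply P0 | reflexivity].
Qed.

(** The vector (conj z_1, - conj z_0, 0, ...) is orthogonal to z; when z_0 = z_1 = 0 the first basis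
    vector is. This is where n >= 2 enters. *)
Lemma exists_orthogonal (n : nat) (z : nat -> C) : (2 <= n)%nat ->
  exists X, sqnorm n X <> 0 /\ herm n X z = 0.
Proof.
intros Hn.
assert (tail : forall X : nat -> C, (forall j, (2 <= j)%nat -> X j = 0) ->
  forall Z m, herm (2 + m) X Z = herm 2 X Z).
{ intros X HX Z m. induction m as [|m IH]; [reflexivity|].
  transitivity (herm (2 + m) X Z + X (2 + m)%nat * Cconj (Z (2 + m)%nat))%C; [reflexivity|].
  rewrite IH, (HX (2 + m)%nat) by lia. ring. }
assert (key : forall x y : C, (x <> 0 \/ y <> 0) -> (x * Cconj (z 0%nat) + y * Cconj (z 1%nat) = 0)%C ->
  exists X, sqnorm n X <> 0 /\ herm n X z = 0).
{ intros x y Hxy E.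
  set (X := fun j : nat => match j with O => x | 1%nat => y | _ => RtoC 0 end).
  assert (HX : forall j, (2 <= j)%nat -> X j = 0).
  { intros [|[|j]] Hj; [lia | lia | reflexivity]. }
  exists X. replace n with (2 + (n - 2))%nat by lia. split.
  - rewrite sqnorm_herm, tail, <- sqnorm_herm by exact HX. unfold sqnorm. simpl sumR.
    assert (A := pow2_ge_0 (Cmod x)). assert (B := pow2_ge_0 (Cmod y)).
    destruct Hxy as [Hx|Hx]; apply Cmod_gt_0 in Hx; assert (T := pow_lt _ 2 Hx); simpl in *; lra.
  - rewrite tail by exact HX. unfold herm. simpl. rewrite Cplus_0_l. exact E. }
destruct (classic (z 0%nat = 0 /\ z 1%nat = 0)) as [[E0 E1]|N].
- apply (key 1 0).
  + left. intros E. apply RtoC_inj in E. lra.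
  + rewrite E0, E1. unfold Cconj, RtoC, Cmult, Cplus; simpl. f_equal; ring.
- apply (key (Cconj (z 1%nat)) (- Cconj (z 0%nat))%C); [|ring].
  apply NNPP. intros H. apply N. split.
  + apply NNPP. intros K. apply H. right. intros E. apply K.
    rewrite <- (Cconj_conj (z 0%nat)). replace (Cconj (z 0%nat)) with (- (- Cconj (z 0%nat)))%C by ring.
    rewrite E. unfold Cconj, Copp, RtoC; simpl. f_equal; ring.
  + apply NNPP. intros K. apply H. left. intros E. apply K.
    rewrite <- (Cconj_conj (z 1%nat)), E. unfold Cconj, RtoC; simpl. f_equal; ring.
Qed.

(* v(r) ~ 1 / |ln r| dominates r^2 u^2 ~ 1 / ln^2 r. *)
Lemma orthogonal_curvature_bound (r : R) : 0 < r < / 2 -> 4 < - ln r ->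
  0 < coef_a r /\ (- ln r - 2) / 8 <= - 4 * coef_b r / coef_a r ^ 2.
Proof.
intros Hr Hl. set (l := - ln r) in *.
assert (B := v_bounds r Hr). fold l in B. destruct B as [B1 B2].
assert (V := v_nonneg r ltac:(lra)).
assert (Ha : 0 < coef_a r).
{ unfold coef_a. assert (0 <= v r / r) by (apply Rdiv_le_0_compat; lra). lra. }
split; [exact Ha|].
assert (E : - 4 * coef_b r / coef_a r ^ 2 = 4 * (v r - (1 - r) ^ 2 / l ^ 2) / (r + v r) ^ 2).
{ unfold coef_b, coef_a in *. rewrite u_off_1 by lra. unfold l in *. field. repeat split; try lra.
  }
rewrite E.
(* From exp l >= 1 + l with exp l = 1 / r. Together with v r <= 1 / l it bounds the denominator by
   (2 / l)^2. *)
assert (Hrl : r <= / l).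
{ assert (T := exp_ineq1_le l). assert (X : exp l = / r).
  { unfold l. rewrite exp_Ropp, exp_ln by lra. reflexivity. }
  rewrite X in T. rewrite <- (Rinv_inv r). apply Rinv_le_contravar; lra. }
assert (Hv : 0 < r + v r) by lra.
assert (Hc : / 4 <= (1 - r) ^ 2).
{ replace (/ 4) with ((/ 2) ^ 2) by field. apply pow_incr. lra. }
set (c := (1 - r) ^ 2) in *.
(* The lower bound c / (2 l) for v leaves c (l - 2) / (2 l^2) after subtracting c / l^2, and c >=
   1/4 because r < 1/2. *)
assert (Num : (l - 2) / (8 * l ^ 2) <= v r - c / l ^ 2).
{ assert (X : / 4 * ((l - 2) / (2 * l ^ 2)) <= c * ((l - 2) / (2 * l ^ 2))).
  { apply Rmult_le_compat_r; [|exact Hc]. apply Rdiv_le_0_compat; [lra|].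
    assert (0 < l ^ 2) by (apply pow_lt; lra). lra. }
  replace (/ 4 * ((l - 2) / (2 * l ^ 2))) with ((l - 2) / (8 * l ^ 2)) in X by (field; lra).
  replace (c * ((l - 2) / (2 * l ^ 2))) with (c / (2 * l) - c / l ^ 2) in X by (field; lra).
  lra. }
assert (Den : (r + v r) ^ 2 <= 4 / l ^ 2).
{ replace (4 / l ^ 2) with ((/ l + / l) ^ 2) by (field; lra). apply pow_incr. lra. }
assert (D0 : 0 < (r + v r) ^ 2) by (apply pow_lt; exact Hv).
assert (L2 : 0 < l ^ 2) by (apply pow_lt; lra).
apply Rmult_le_reg_r with ((r + v r) ^ 2); [exact D0|].
replace (4 * (v r - c / l ^ 2) / (r + v r) ^ 2 * (r + v r) ^ 2) with (4 * (v r - c / l ^ 2))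
  by (field; lra).
apply Rle_trans with ((l - 2) / 8 * (4 / l ^ 2)); [apply Rmult_le_compat_l; lra|].
replace ((l - 2) / 8 * (4 / l ^ 2)) with (4 * ((l - 2) / (8 * l ^ 2))) by (field; lra). lra.
Qed.

Lemma Kplus_blowup (n : nat) : (2 <= n)%nat ->
  forall M : R, exists delta : R, 0 < delta /\ forall z : nat -> C,
    0 < sqrt (sqnorm n z) < delta -> Rbar_lt (Finite M) (Kplus n z).
Proof.
(* For |z| < exp (- K) one has - ln r > 2 K = 8 |M| + 4, so the lower bound (- ln r - 2) / 8 exceeds
   |M|. The same inequality yields - ln r > 4 and r < 1/2. *)
intros Hn M. set (K := 4 * Rabs M + 2).
assert (M0 := Rabs_pos M). assert (M1 := Rle_abs M).
exists (exp (- K)). split; [apply exp_pos|]. intros z Hz.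
set (r := sqnorm n z) in *.
assert (Hr : 0 < r).
{ destruct (Rle_lt_dec r 0) as [H|H]; [|exact H]. rewrite sqrt_neg_0 in Hz by exact H. lra. }
assert (Hl : ln r < - (2 * K)).
{ rewrite <- (sqrt_sqrt r) by lra. rewrite ln_mult by lra.
  assert (T := ln_increasing _ _ (proj1 Hz) (proj2 Hz)). rewrite ln_exp in T. lra. }
assert (Hr2 : r < / 2).
{ rewrite <- (exp_ln r Hr). apply Rlt_trans with (exp (- (4))); [apply exp_increasing; unfold K in *; lra|].
  rewrite exp_Ropp. apply Rinv_lt_contravar; [assert (T := exp_pos 4); lra|].
  assert (T := exp_ineq1_le 4). lra. }
destruct (orthogonal_curvature_bound r ltac:(lra) ltac:(unfold K in *; lra)) as [Ha Hk].
destruct (exists_orthogonal n z Hn) as (X & HX & Ho).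
apply Rbar_lt_le_trans with (Finite (- 4 * coef_b r / coef_a r ^ 2)).
- simpl. unfold K in *. simpl in Hk. lra.
- eapply Rbar_le_trans.
  + apply (linear_disk_curvature n z X); fold r; auto; lra.
  + apply (proj1 (Rbar_lub_correct _)). exists X. auto.
Qed.

(** * The radial direction *)

(* Here z = phi(0) = phi'(0), r = |z|^2, <phi''(0), z> = y1 + i y2 and c = |phi''(0)|^2, so that
   c - (y1^2 + y2^2) / r is the squared norm of the component of phi''(0) orthogonal to z; on the
   complex line through z the metric is q(r) |dT|^2. *)
Lemma radial_log_sum (a b b1 b2 r y1 y2 g1 g2 c t1 t2 : R) : r <> 0 -> a + b * r <> 0 ->
  let q := a + b * r in let q1 := 2 * b + b1 * r in let q2 := 3 * b1 + b2 * r in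
  log_second a b b1 b2 (2 * r) (2 * (y1 + r)) r (2 * y1) (2 * (g1 + c))
    r (y1 + r) (g1 + 3 * y1) 0 y2 t1
  + log_second a b b1 b2 0 (2 * (r - y1)) r (- 2 * y2) (2 * (c - g1))
    r (- y2) (y1 - g1) 0 (y1 - r) t2
  = 4 * (a * (c - (y1 ^ 2 + y2 ^ 2) / r) / (r * q)
         + (r * (r * q2 + q1) * q - r ^ 2 * q1 ^ 2) / q ^ 2).
Proof.
intros Hr Hq. cbv zeta. unfold log_second. field. split; [exact Hq|]. split; [exact Hr|].
replace (a * r + b * r ^ 2) with (r * (a + b * r)) by ring.
apply Rmult_integral_contrapositive_currified; assumption.
Qed.

Lemma herm_self_sub (n : nat) (x y : C) (B z : nat -> C) :
  (herm n (fun j => x * B j - y * z j) (fun j => x * B j - y * z j)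
   = x * Cconj x * herm n B B - x * Cconj y * herm n B z - y * Cconj x * herm n z B
     + y * Cconj y * herm n z z)%C.
Proof.
unfold herm. induction n as [|n IH]; simpl; [ring|].
rewrite IH, Cminus_conj, !Cmult_conj. ring.
Qed.

Lemma herm_cauchy_schwarz (n : nat) (B z : nat -> C) :
  0 < sqnorm n z -> Cmod (herm n B z) ^ 2 / sqnorm n z <= sqnorm n B.
Proof.
intros Hz. set (r := sqnorm n z) in *. set (Y := herm n B z).
(* r times the component of B orthogonal to z, scaled to avoid division; its squared norm is
   nonnegative. *)
set (V := fun j : nat => (r * B j - Y * z j)%C).
assert (E : RtoC (sqnorm n V) = RtoC (r * (r * sqnorm n B - Cmod Y ^ 2))).
{ rewrite <- herm_self, RtoC_mult, RtoC_minus, RtoC_mult, Cmod2_conj, <- (herm_self n B).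
  unfold V. rewrite herm_self_sub, (herm_conj n B z), (herm_self n z). fold Y r.
  replace (Cconj r) with (RtoC r) by (unfold Cconj, RtoC; simpl; f_equal; ring). ring. }
apply RtoC_inj in E. assert (T := sqnorm_nonneg n V). rewrite E in T.
apply Rmult_le_reg_r with r; [exact Hz|].
replace (Cmod Y ^ 2 / r * r) with (Cmod Y ^ 2) by (field; lra).
assert (0 <= r * sqnorm n B - Cmod Y ^ 2); [|lra].
apply Rmult_le_reg_l with r; [exact Hz|]. lra.
Qed.

(* With x = ln r and k = r u^2 = m / x^2, m = 2 (cosh x - 1), this is
   (1 + k) k'' - k'^2 = k'' + k^2 (ln k)'' with derivatives in x. *)
Lemma radial_discriminant_pos (r : R) : 0 < r -> 18 <= ln r ->
  let q := coef_a r + coef_b r * r in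
  let q1 := 2 * coef_b r + coef_b1 r * r in let q2 := 3 * coef_b1 r + coef_b2 r * r in
  0 < q /\ 0 < r * (r * q2 + q1) * q - r ^ 2 * q1 ^ 2.
Proof.
intros Hr HL. cbv zeta. set (L := ln r) in *.
assert (N1 : r <> 1). { intros E. unfold L in HL. rewrite E, ln_1 in HL. lra. }
assert (Hbig : (1 + L / 3) ^ 3 <= r).
{ rewrite <- (exp_ln r Hr). fold L. replace L with (L / 3 + L / 3 + L / 3) at 2 by field.
  rewrite !exp_plus. assert (T := exp_ineq1_le (L / 3)).
  replace ((1 + L / 3) ^ 3) with ((1 + L / 3) * (1 + L / 3) * (1 + L / 3)) by ring.
  assert (0 <= (1 + L / 3) * (1 + L / 3)) by (apply Rmult_le_pos; lra).
  repeat apply Rmult_le_compat; lra. }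
(* The origin of 18: from L = 18 on, the terms L^2 / 3 and L^3 / 27 of the cube add up to at least
   L^2. The conclusion implies m >= L^2, that is 2 (cosh x - 1) >= x^2 at x = L. *)
assert (HrL : L ^ 2 + 2 <= r).
{ assert (L ^ 2 * 18 <= L ^ 2 * L) by (apply Rmult_le_compat_l; [apply pow2_ge_0 | lra]).
  replace ((1 + L / 3) ^ 3) with (1 + L + L ^ 2 / 3 + L ^ 2 * L / 27) in Hbig by field. lra. }
assert (HL2 : 18 * 18 <= L ^ 2).
{ replace (L ^ 2) with (L * L) by ring. apply Rmult_le_compat; lra. }
set (m := r - 2 + / r).
assert (Ir : 0 < / r) by (apply Rinv_0_lt_compat; exact Hr).
(* The terms in v cancel: on the complex line through z the metric is the explicit 1 + r u^2, which
   is why the radial direction is tractable. *)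
assert (Eq : coef_a r + coef_b r * r = 1 + m / L ^ 2).
{ unfold coef_a, coef_b, m. rewrite u_off_1 by exact N1. fold L. field. lra. }
assert (P2 : 0 < L ^ 2) by lra.
split.
- rewrite Eq. assert (0 <= m / L ^ 2) by (apply Rdiv_le_0_compat; unfold m; lra). lra.
(* With m' = r - 1 / r and m'' = m + 2 in the variable x, the first summand is k''. Moreover (ln
   m)'' = - 2 / m, so the second summand, k^2 (ln k)'', has the sign of m - L^2. *)
- replace (r * (r * (3 * coef_b1 r + coef_b2 r * r) + (2 * coef_b r + coef_b1 r * r))
     * (coef_a r + coef_b r * r) - r ^ 2 * (2 * coef_b r + coef_b1 r * r) ^ 2)
  with ((L ^ 2 * (m + 2) - 4 * L * (r - / r) + 6 * m) / L ^ 4 + 2 * m * (m - L ^ 2) / L ^ 6).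
  + apply Rplus_lt_le_0_compat.
    * apply Rdiv_lt_0_compat; [|apply pow_lt; lra].
      replace (L ^ 2 * (m + 2) - 4 * L * (r - / r) + 6 * m) with
        ((L - 4) * L * r + (L ^ 2 + 4 * L) * / r + 6 * m) by (unfold m; ring).
      assert (0 < (L - 4) * L * r) by (repeat apply Rmult_lt_0_compat; lra).
      assert (0 < (L ^ 2 + 4 * L) * / r) by (apply Rmult_lt_0_compat; lra).
      unfold m. lra.
    * apply Rdiv_le_0_compat; [|apply pow_lt; lra].
      apply Rmult_le_pos; unfold m; lra.
  + unfold coef_a, coef_b, coef_b1, coef_b2, sq0, sq1, sq2, m. rewrite u_off_1 by exact N1. fold L.
    field. lra.
Qed.

(** There are finitely many components, so a common positive radius exists. [epsilon] turns
    pointwise existence into a function, which lets the lemma be iterated: once for phi'' and once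
    for phi'''. *)
Lemma cdiff_choice (f : nat -> C -> C) (df : nat -> C -> C) (n : nat) (r : R) : 0 < r ->
  (forall j, (j < n)%nat -> forall w, Cmod w < r -> cdiff (f j) w (df j w)) ->
  exists r' (d2 : nat -> C -> C), 0 < r' <= r /\
    forall j, (j < n)%nat -> forall w, Cmod w < r' -> cdiff (df j) w (d2 j w).
Proof.
intros Hr H.
assert (Hu : exists r', 0 < r' <= r /\
  forall j, (j < n)%nat -> forall w, Cmod w < r' -> exists l, cdiff (df j) w l).
{ induction n as [|n IH].
  - exists r. split; [lra|]. intros j Hj. lia.
  - destruct IH as (r1 & H1 & K1); [intros; apply H; auto|].
    destruct (derivative_cdiff (f n) (df n) r Hr) as (r2 & H2 & K2); [intros; apply H; auto|].
    exists (Rmin r1 r2). assert (A := Rmin_l r1 r2). assert (B := Rmin_r r1 r2).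
    split; [split; [apply Rmin_glb_lt; lra | lra]|].
    intros j Hj w Hw. destruct (Nat.eq_dec j n) as [->|Nj].
    + apply K2. lra.
    + apply K1; [lia | lra]. }
destruct Hu as (r' & Hr' & K).
exists r', (fun j w => epsilon (inhabits (RtoC 0)) (fun l => cdiff (df j) w l)).
split; [exact Hr'|]. intros j Hj w Hw. apply epsilon_spec. apply K; assumption.
Qed.

Lemma radial_curvature_bound (n : nat) (z : nat -> C) (phi dphi : C -> nat -> C) :
  0 < sqnorm n z -> 18 <= ln (sqnorm n z) -> admissible n z z phi dphi ->
  let r := sqnorm n z in let q := coef_a r + coef_b r * r in
  let q1 := 2 * coef_b r + coef_b1 r * r in let q2 := 3 * coef_b1 r + coef_b2 r * r in
  gauss_curv_at0 (fun T => grauert n (phi T) (dphi T))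
  <= - 2 * (r * (r * q2 + q1) * q - r ^ 2 * q1 ^ 2) / (r * q ^ 3).
Proof.
intros Hz HL ((r0 & Hr0 & Hd) & H0).
destruct (radial_discriminant_pos _ Hz HL) as [Hq HD]. cbv zeta in *.
set (r := sqnorm n z) in *.
assert (N1 : r <> 1). { intros E. rewrite E, ln_1 in HL. lra. }
assert (C0 : forall j, (j < n)%nat -> forall w, Cmod w < r0 ->
  cdiff (fun w => phi w j) w (dphi w j)).
{ intros j Hj w Hw. apply cdiff_is_derive. apply (Hd w Hw). exact Hj. }
destruct (cdiff_choice (fun j w => phi w j) (fun j w => dphi w j) n r0 Hr0 C0)
  as (r1 & d2 & Hr1 & C1).
destruct (cdiff_choice (fun j w => dphi w j) d2 n r1 (proj1 Hr1) C1) as (r2 & d3 & Hr2 & C2).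
assert (Ez : forall j, (j < n)%nat -> phi 0 j = z j) by (intros j Hj; apply H0; exact Hj).
assert (EX : forall j, (j < n)%nat -> dphi 0 j = z j) by (intros j Hj; apply H0; exact Hj).
assert (Sz : sqnorm n (phi 0) = r) by (apply sqnorm_ext; exact Ez).
assert (SX : sqnorm n (dphi 0) = r) by (apply sqnorm_ext; exact EX).
assert (HXz : herm n (dphi 0) (phi 0) = RtoC r).
{ unfold r. rewrite <- herm_self. apply herm_ext; assumption. }
assert (HBz : forall B, herm n B (phi 0) = herm n B z) by (intros; apply herm_ext; auto).
assert (HBX : forall B, herm n B (dphi 0) = herm n B z) by (intros; apply herm_ext; auto).
assert (Eg : grauert n (phi 0) (dphi 0) = r * (coef_a r + coef_b r * r)).
{ rewrite grauert_coef, Sz, SX, HXz, Cmod_R, Rabs_right by lra. ring. }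
set (B := fun j => d2 j 0). set (D := fun j => d3 j 0).
rewrite (gauss_curv_jet n phi dphi (fun T j => d2 j T) (fun T j => d3 j T) r2).
2: lra.
2:{ intros T HT j Hj. split; [apply C0; [exact Hj | lra]|].
    split; [apply C1; [exact Hj | lra] | apply C2; assumption]. }
2: rewrite Sz; exact Hz.
2: rewrite Sz; exact N1.
2:{ rewrite Eg. apply Rmult_lt_0_compat; assumption. }
fold B D. rewrite Eg.
assert (CS := herm_cauchy_schwarz n B z Hz). fold r in CS.
rewrite Cmod2_alt in CS.
unfold axis_log_second. rewrite Sz, SX, HXz, !HBz, !HBX.
destruct (herm n B z) as [y1 y2]. destruct (herm n D z) as [g1 g2].
set (c := sqnorm n B) in *. simpl Re in CS. simpl Im in CS.
set (a := coef_a r) in *. set (b := coef_b r) in *. set (b1 := coef_b1 r) in *. set (b2 := coef_b2 r) in *.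
match goal with |- _ * (?x + ?y) <= _ => replace (x + y) with
  (4 * (a * (c - (y1 ^ 2 + y2 ^ 2) / r) / (r * (a + b * r))
   + (r * (r * (3 * b1 + b2 * r) + (2 * b + b1 * r)) * (a + b * r)
       - r ^ 2 * (2 * b + b1 * r) ^ 2) / (a + b * r) ^ 2)) end.
- set (q := a + b * r) in *.
  set (Dd := r * (r * (3 * b1 + b2 * r) + (2 * b + b1 * r)) * q - r ^ 2 * (2 * b + b1 * r) ^ 2) in *.
  replace (- 2 * Dd / (r * q ^ 3)) with (- 2 / (r * q) * (Dd / q ^ 2)) by (field; lra).
  replace (- 2 / (r * q) * / 4 * (4 * (a * (c - (y1 ^ 2 + y2 ^ 2) / r) / (r * q) + Dd / q ^ 2)))
   with (- 2 / (r * q) * (Dd / q ^ 2) - 2 * a * (c - (y1 ^ 2 + y2 ^ 2) / r) / (r * q) ^ 2)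
   by (field; lra).
  assert (Ha : 0 < a).
  { unfold a, coef_a. assert (T := v_nonneg r Hz).
    assert (0 <= v r / r) by (apply Rdiv_le_0_compat; lra). lra. }
  assert (0 <= 2 * a * (c - (y1 ^ 2 + y2 ^ 2) / r) / (r * q) ^ 2); [|lra].
  apply Rdiv_le_0_compat.
  + apply Rmult_le_pos; lra.
  + apply pow_lt. apply Rmult_lt_0_compat; assumption.
(* [t1] and [t2] are the second derivatives of Im <phi', phi> along the axes. They only occur
   multiplied by its value Im <z, z> = 0, so they are taken from the goal as they stand. *)
- match goal with |- _ = log_second _ _ _ _ _ _ _ _ _ _ _ _ _ _ ?t1 + log_second _ _ _ _ _ _ _ _ _ _ _ _ _ _ ?t2 =>
    rewrite <- (radial_log_sum a b b1 b2 r y1 y2 g1 g2 c t1 t2) by lra end.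
  f_equal; f_equal; unfold Re, Im, Cmult, Cplus, Cconj, RtoC, Ci; simpl; ring.
Qed.

Lemma Kminus_negative (n : nat) : exists R0 : R, 0 < R0 /\
  forall z : nat -> C, R0 <= sqrt (sqnorm n z) -> Rbar_lt (Kminus n z) (Finite 0).
Proof.
(* |z| >= exp 9 means ln (|z|^2) >= 18, the threshold of [radial_discriminant_pos]. *)
exists (exp 9). split; [apply exp_pos|]. intros z Hz.
assert (E9 := exp_pos 9).
assert (Hr : exp 18 <= sqnorm n z).
{ replace 18 with (9 + 9) by ring. rewrite exp_plus.
  rewrite <- (sqrt_sqrt (sqnorm n z)) by apply sqnorm_nonneg. apply Rmult_le_compat; lra. }
assert (E18 := exp_pos 18).
assert (HL : 18 <= ln (sqnorm n z)).
{ rewrite <- (ln_exp 18). destruct Hr as [Hr|Hr].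
  - left. apply ln_increasing; assumption.
  - right. rewrite Hr. reflexivity. }
assert (Hp : 0 < sqnorm n z) by lra.
destruct (radial_discriminant_pos _ Hp HL) as [Hq HD]. cbv zeta in Hq, HD.
set (r := sqnorm n z) in *.
set (q := coef_a r + coef_b r * r) in *.
set (D := r * (r * (3 * coef_b1 r + coef_b2 r * r) + (2 * coef_b r + coef_b1 r * r)) * q
   - r ^ 2 * (2 * coef_b r + coef_b1 r * r) ^ 2) in *.
(* The bound is the same for all disks, so strict negativity survives the supremum over them. *)
apply Rbar_le_lt_trans with (Finite (- 2 * D / (r * q ^ 3))).
- apply Rbar_le_trans with (hsc n z z).
  + apply (proj1 (Rbar_glb_correct _)). exists z. split; [fold r; lra | reflexivity].
  + apply (proj2 (Rbar_lub_correct _)). intros k (phi & dphi & Ha & ->).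
    exact (radial_curvature_bound n z phi dphi Hp HL Ha).
- change (- 2 * D / (r * q ^ 3) < 0). assert (0 < D / (r * q ^ 3)).
  { apply Rdiv_lt_0_compat; [exact HD|]. apply Rmult_lt_0_compat; [exact Hp|]. apply pow_lt. exact Hq. }
  replace (- 2 * D / (r * q ^ 3)) with (- 2 * (D / (r * q ^ 3))) by (unfold Rdiv; ring). lra.
Qed.

Theorem theorem1p1 (n : nat) (hn : (2 <= n)%nat) :
  (forall M : R, exists delta : R, 0 < delta /\
     forall z : nat -> C,
       0 < sqrt (sqnorm n z) < delta -> Rbar_lt (Finite M) (Kplus n z)) /\
  (exists R0 : R, 0 < R0 /\
     forall z : nat -> C,
       R0 <= sqrt (sqnorm n z) -> Rbar_lt (Kminus n z) (Finite 0)).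
Proof.
split; [apply Kplus_blowup; exact hn | apply Kminus_negative].
Qed.
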